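(* For all partitions $\mu,\lambda$, the repeated insertion process $\Psi_{\mu,\lambda}$ described below always terminates, and it is a weight-preserving bijection $$\Psi_{\mu,\lambda} \colon \mathcal B(\mu,\lambda) \times \mathcal W(\mu,\lambda) \longrightarrow \bigcup_{\nu} \mathcal B(\nu,\lambda),$$ where the union is over all partitions $\nu$ with $\mu\lessdot\nu\subseteq\lambda$, the weight of a pair $(T,z)$ is $w(T)\,z$, and the weight of a tableau in the target is $w$.
   Context: Partitions are extended by zeros ($\lambda_i=0$ for $i>\ell(\lambda)$), $\lambda'$ is the conjugate, $[\mu]=\{(i,j): i\ge1,1\le j\le\mu_i\}$, $\mu\subseteq\lambda$ means $[\mu]\subseteq[\lambda]$, $\mu\lessdot\nu$ means $\mu\subseteq\nu$ and $|\nu|=|\mu|+1$. An outer corner of $\mu$ is a cell $(i,j)\notin[\mu]$ with ($i=1$ or $(i-1,j)\in[\mu]$) and ($j=1$ or $(i,j-1)\in[\mu]$). A bicolored tableau of shape $\mu$ is a map $T:[\mu]\to\mathbb{Z}_{\ge0}$ weakly increasing along rows and down columns, with each entry colored black or red; $\mathcal B(\mu)$ denotes the set of these. With commuting indeterminates $x_1,x_2,\dots,y_1,y_2,\dots$, the entry in cell $(i,j)$ represents $x_{i+T_{ij}}$ if black and $y_{j+T_{ij}}$ if red; $w(T)$ is the product of the represented variables. $\mathcal B(\mu,\lambda)$ is the set of $T\in\mathcal B(\mu)$ with $j+T_{ij}\le\lambda_{i+T_{ij}}$ for all $(i,j)\in[\mu]$. $\mathcal W(\mu,\lambda)=\{x_k: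 \lambda_k-k\ne\mu_i-i \text{ for all } i\ge1\}\cup\{y_k:\lambda'_k-k\ne\mu'_j-j\text{ for all } j\ge1\}$. Insertion $\psi_\mu(T,z)$ for $T\in\mathcal B(\mu)$ and a variable $z$: start with $i=j=0$, $w=z$, $S=T$. Repeat: if $w=x_k$, increase $j$ by $1$ and choose the largest $i$ (allowed $1\le i\le\mu'_j$, and also $i=\mu'_j+1$ if $j=1$ or $\mu'_j<\mu'_{j-1}$) such that putting a black entry $k-i$ in position $(i,j)$ (replacing $S_{ij}$ if present) leaves column $j$ consisting of non-negative integers weakly increasing downward; if $w=y_k$, increase $i$ by $1$ and choose the largest $j$ (allowed $1\le j\le\mu_i$, and also $j=\mu_i+1$ if $i=1$ or $\mu_i<\mu_{i-1}$) such that putting a red entry $k-j$ in position $(i,j)$ leaves row $i$ consisting of non-negative integers weakly increasing rightward. Place it; if $(i,j)\in[\mu]$, let the new $w$ be the variable represented by the replaced entry and repeat; if $(i,j)$ is an outer corner of $\mu$, stop and output $S=\psi_\mu(T,z)$, a bicolored tableau of a shape $\nu$ covering $\mu$. Repeated insertion $\Psi_{\mu,\lambda}(T,z)$: compute $S=\psi_\mu(T,z)$; while $S\notin\bigcup_{\mu\lessdot\nu\subseteq\lambda}\mathcal B(\nu,\lambda)$, remove the entry of $S$ in the unique cell of $[\nu]\setminus[\mu]$, obtaining a tableau $T'$ of shape $\mu$ and the variable $z'$ represented by the removed entry, and replace $S$ by $\psi_\mu(T',z')$. Output the final $S$. *)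

(* Defs.v *)
From HB Require Import structures.
From mathcomp Require Import all_boot all_order all_algebra.
From mathcomp Require Import finmap.
From mathcomp Require Import classical_sets functions.
From mathcomp.multinomials Require Import monalg.

Set Implicit Arguments.
Unset Strict Implicit.
Unset Printing Implicit Defensive.

Local Open Scope fset_scope.
Local Open Scope fmap_scope.
Local Open Scope nat_scope.

(* Parts, rows, columns and variables are all indexed from 1. *)

Record partition_shape := PartitionShape {
  parts :> seq nat;
  partsP : sorted geq parts && (0 \notin parts) }.

HB.instance Definition _ := [isSub for parts].

(* part la 0 is a junk value, never used. *)
Definition part (la : partition_shape) (i : nat) : nat := nth 0 la i.-1.

(* The j-th part of the conjugate partition, for j >= 1. *)
Definition cpart (la : partition_shape) (j : nat) : nat := count (leq j) la.

Definition cell := (nat * nat)%type.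

Definition diagram (mu : partition_shape) : {fset cell} :=
  [fset c in [seq (i, j) | i <- iota 1 (size mu), j <- iota 1 (part mu i)]].

Lemma in_diagram (mu : partition_shape) (i j : nat) :
  ((i, j) \in diagram mu) = (0 < i) && (0 < j <= part mu i).
Proof.
rewrite in_fset /= /part; apply/allpairsPdep/idP.
  move=> [a [b []]]; rewrite !mem_iota !add1n !ltnS => /andP[a0 _] /andP[b0 hb].
  by case=> -> ->; rewrite a0 b0.
move=> /andP[i0 /andP[j0 hj]]; exists i, j; split=> //.
  rewrite mem_iota i0 add1n ltnS leqNgt; apply: contraTN hj => hi.
  by rewrite nth_default -?ltnNge // -ltnS prednK.
by rewrite mem_iota j0 add1n ltnS.
Qed.

Definition contained (mu la : partition_shape) : Prop :=
  diagram mu `<=` diagram la.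

Definition covered (mu nu : partition_shape) : Prop :=
  contained mu nu /\ sumn nu = (sumn mu).+1.

Definition outer_corner (mu : partition_shape) (c : cell) : Prop :=
  let: (i, j) := c in
  [/\ 0 < i, 0 < j, (i, j) \notin diagram mu,
      i = 1 \/ (i.-1, j) \in diagram mu
    & j = 1 \/ (i, j.-1) \in diagram mu].

Inductive var := X_ of nat | Y_ of nat.

Definition var_code (z : var) : nat + nat :=
  match z with X_ k => inl k | Y_ k => inr k end.
Definition var_decode (s : nat + nat) : var :=
  match s with inl k => X_ k | inr k => Y_ k end.
Lemma var_codeK : cancel var_code var_decode. Proof. by case. Qed.
HB.instance Definition _ := Choice.copy var (can_type var_codeK).

Inductive color := Black | Red.

Definition entry := (color * nat)%type.

(* The variable represented by the entry e placed in cell c. *)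
Definition repr_var (c : cell) (e : entry) : var :=
  match e with
  | (Black, t) => X_ (c.1 + t)
  | (Red, t) => Y_ (c.2 + t)
  end.

(* A finite map, whose domain is the set of filled cells. *)
Definition filling := {fmap cell -> entry}.

Definition row_weakly_increasing (S : filling) (i : nat) : Prop :=
  forall (j1 j2 : nat) (e1 e2 : entry), j1 <= j2 ->
    S.[? (i, j1)] = Some e1 -> S.[? (i, j2)] = Some e2 -> e1.2 <= e2.2.

Definition col_weakly_increasing (S : filling) (j : nat) : Prop :=
  forall (i1 i2 : nat) (e1 e2 : entry), i1 <= i2 ->
    S.[? (i1, j)] = Some e1 -> S.[? (i2, j)] = Some e2 -> e1.2 <= e2.2.

Definition bicolored_tableaux (mu : partition_shape) : set filling :=
  [set T : filling | [/\ domf T = diagram mu,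
                         forall i, row_weakly_increasing T i
                       & forall j, col_weakly_increasing T j]]%classic.

Definition bounded_tableaux (mu la : partition_shape) : set filling :=
  [set T : filling | bicolored_tableaux mu T /\
     forall (i j : nat) (e : entry), T.[? (i, j)] = Some e ->
       j + e.2 <= part la (i + e.2)]%classic.

(* The union of the sets B(nu, la) over mu <. nu \subseteq la. *)
Definition covering_tableaux (mu la : partition_shape) : set filling :=
  [set S : filling | exists nu : partition_shape,
     [/\ covered mu nu, contained nu la & bounded_tableaux nu la S]]%classic.

Definition admissible_vars (mu la : partition_shape) : set var :=
  [set z : var |
     match z with
     | X_ k => 1 <= k /\ forall i, 1 <= i ->
         ((part la k)%:Z - k%:Z <> (part mu i)%:Z - i%:Z)%R
     | Y_ k => 1 <= k /\ forall j, 1 <= j ->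
         ((cpart la k)%:Z - k%:Z <> (cpart mu j)%:Z - j%:Z)%R
     end]%classic.

(* Weights are monomials in the commuting indeterminates X_ k and Y_ k. *)
Definition weight (T : filling) : {cmonom var} :=
  \big[mmul/mone]_(c : domf T) ucm (repr_var (val c) (T c)).

Definition pair_weight (p : filling * var) : {cmonom var} :=
  mmul (weight p.1) (ucm p.2).

Definition allowed_row (mu : partition_shape) (j i : nat) : Prop :=
  1 <= i <= cpart mu j \/
  i = (cpart mu j).+1 /\ (j = 1 \/ cpart mu j < cpart mu j.-1).

Definition allowed_col (mu : partition_shape) (i j : nat) : Prop :=
  1 <= j <= part mu i \/
  j = (part mu i).+1 /\ (i = 1 \/ part mu i < part mu i.-1).

(* The hypotheses i <= k and j <= k say that the new entry is non-negative. *)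
Definition fits_in_col (mu : partition_shape) (S : filling) (k j i : nat) :
    Prop :=
  [/\ allowed_row mu j i, i <= k
    & col_weakly_increasing S.[(i, j) <- (Black, k - i)] j].

Definition fits_in_row (mu : partition_shape) (S : filling) (k i j : nat) :
    Prop :=
  [/\ allowed_col mu i j, j <= k
    & row_weakly_increasing S.[(i, j) <- (Red, k - j)] i].

Definition largest (P : nat -> Prop) (n : nat) : Prop :=
  P n /\ forall m, P m -> m <= n.

(* placement mu S c w c' e: when the current filling is S, the current position
   is c and the variable to be inserted is w, the entry e is put in cell c'. *)
Inductive placement (mu : partition_shape) (S : filling) :
    cell -> var -> cell -> entry -> Prop :=
| placement_black (i j k i' : nat) :
    largest (fits_in_col mu S k j.+1) i' ->
    placement mu S (i, j) (X_ k) (i', j.+1) (Black, k - i')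
| placement_red (i j k j' : nat) :
    largest (fits_in_row mu S k i.+1) j' ->
    placement mu S (i, j) (Y_ k) (i.+1, j') (Red, k - j').

(* insertion_from mu S c w S': the insertion loop, entered with current filling
   S, position c and variable w, stops and outputs S'. Every step of the loop is
   deterministic, so the existence of S' means that the loop terminates. *)
Inductive insertion_from (mu : partition_shape) :
    filling -> cell -> var -> filling -> Prop :=
| insertion_stop (S : filling) (c : cell) (w : var) (c' : cell) (e : entry) :
    placement mu S c w c' e -> outer_corner mu c' ->
    insertion_from mu S c w S.[c' <- e]
| insertion_bump (S : filling) (c : cell) (w : var) (c' : cell)
    (e old : entry) (S' : filling) :
    placement mu S c w c' e -> c' \in diagram mu -> S.[? c'] = Some old ->
    insertion_from mu S.[c' <- e] c' (repr_var c' old) S' ->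
    insertion_from mu S c w S'.

(* The graph of psi_mu. *)
Definition insertion (mu : partition_shape) (T : filling) (z : var)
    (S : filling) : Prop :=
  insertion_from mu T (0, 0) z S.

(* The graph of Psi_{mu,la}: the (deterministic) repeated insertion process
   started from (T, z) terminates with output S. *)
Inductive repeated_insertion (mu la : partition_shape) :
    filling -> var -> filling -> Prop :=
| repeated_insertion_stop (T : filling) (z : var) (S : filling) :
    insertion mu T z S -> covering_tableaux mu la S ->
    repeated_insertion mu la T z S
| repeated_insertion_again (T : filling) (z : var) (S : filling)
    (c : cell) (e : entry) (S' : filling) :
    insertion mu T z S -> ~ covering_tableaux mu la S ->
    domf S `\` diagram mu = [fset c] -> S.[? c] = Some e ->
    repeated_insertion mu la S.[~ c] (repr_var c e) S' ->
    repeated_insertion mu la T z S'.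

(* Main.v *)
(* The whole process is one injective dynamics on a finite set. A state consists
   of a filling S in B(mu, la), a current cell and a variable w. When the
   insertion reaches an outer corner where the bound given by la fails, removing
   the new entry and inserting it again restarts from the same S and w at cell
   (0, 0). A step is either a bump or such a restart.

   Each step can be undone: a bumped variable determines the cell it came from,
   and the corner of a restart is determined by w, because w satisfied the bound
   in the cell it was bumped from, one line earlier. The variables that do not
   arise from a restart are exactly those of W(mu, la), since restarts come from
   an equality la_k - k = mu_m - m (or its conjugate). So initial states are the
   states without predecessor, states without successor correspond to outputs,
   and finiteness matches the former with the latter bijectively. *)

From Stdlib Require Import Relations.
Require Import Defs.
From mathcomp Require Import all_boot all_order all_algebra.
From mathcomp Require Import finmap zify.
From mathcomp Require Import classical_sets functions boolp.
From mathcomp.multinomials Require Import monalg.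

Set Implicit Arguments.
Unset Strict Implicit.
Unset Printing Implicit Defensive.

Local Open Scope fset_scope.
Local Open Scope fmap_scope.
Local Open Scope nat_scope.

(** * Diagrams *)

(** In a weakly decreasing sequence the entries that are at least [j] form a prefix, whose length is
    the count. *)
Lemma ltn_count_nth (s : seq nat) (i j : nat) :
  sorted geq s -> 0 < j -> (i < count (leq j) s) = (j <= nth 0 s i).
Proof.
move=> + j0; elim: s i => [|x s IHs] i /=; first by rewrite nth_nil; lia.
rewrite (path_sortedE (rev_trans leq_trans)) => /andP[sx /IHs {}IHs].
have [jx|xj] := leqP j x; first by case: i => [|i] //=; rewrite add1n ltnS IHs.
have s0 : count (leq j) s = 0.
  apply/eqP; rewrite -leqn0 leqNgt -has_count; apply/hasPn => y /(allP sx) /=.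
  by rewrite -ltnNge => /leq_ltn_trans; apply.
rewrite s0 /=; case: i => [|i] /=; first by lia.
by rewrite -IHs s0.
Qed.

Lemma leq_cpart (la : partition_shape) (i j : nat) :
  0 < i -> 0 < j -> (i <= cpart la j) = (j <= part la i).
Proof.
case: i => // i _ j0; rewrite /cpart /part /= ltn_count_nth //.
by case/andP: (partsP la).
Qed.

(* Black entries refer to rows and are inserted into columns, red entries refer
   to columns and are inserted into rows. Writing a cell as [place b r l], where
   [l] is the line into which an entry of color [b] is inserted and [r] the
   position in that line, treats both colors at once. *)
Definition place (b : color) (r l : nat) : cell :=
  if b is Black then (r, l) else (l, r).
Definition pos (b : color) (c : cell) : nat := if b is Black then c.1 else c.2.
Definition line (b : color) (c : cell) : nat := if b is Black then c.2 else c.1.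
Definition flip (b : color) : color := if b is Black then Red else Black.
Definition bvar (b : color) (k : nat) : var := if b is Black then X_ k else Y_ k.
Definition bpart (b : color) : partition_shape -> nat -> nat :=
  if b is Black then part else cpart.

Definition dg (b : color) (mu : partition_shape) (r l : nat) : bool :=
  place b r l \in diagram mu.

Lemma placeK (b : color) (c : cell) : place b (pos b c) (line b c) = c.
Proof. by case: b c => [] []. Qed.

Lemma pos_place (b : color) (r l : nat) : pos b (place b r l) = r.
Proof. by case: b. Qed.

Lemma line_place (b : color) (r l : nat) : line b (place b r l) = l.
Proof. by case: b. Qed.

Lemma color_flip (b b' : color) : b' = b \/ b' = flip b.
Proof. by case: b b' => [] []; [left | right | right | left]. Qed.

Lemma place_flip (b : color) (r l : nat) : place (flip b) r l = place b l r.
Proof. by case: b. Qed.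

Lemma place_eq (b : color) (r l r' l' : nat) :
  (place b r l == place b r' l') = (r == r') && (l == l').
Proof. by case: b; rewrite xpair_eqE // andbC. Qed.

Lemma bvarP (w : var) : exists b k, w = bvar b k.
Proof. by case: w => k; [exists Black | exists Red]; exists k. Qed.

Lemma bvar_inj (b b' : color) (k k' : nat) :
  bvar b k = bvar b' k' -> b = b' /\ k = k'.
Proof. by case: b b' => [] [] //= [->]. Qed.

Lemma repr_varE (c : cell) (b : color) (t : nat) :
  repr_var c (b, t) = bvar b (pos b c + t).
Proof. by case: b. Qed.

Lemma repr_var_inj (c : cell) : injective (repr_var c).
Proof.
by move=> [b t] [b' t']; rewrite !repr_varE => /bvar_inj[<- /addnI ->].
Qed.

Lemma dgE (b : color) (mu : partition_shape) (r l : nat) :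
  dg b mu r l = [&& 0 < r, 0 < l & l <= bpart b mu r].
Proof.
case: b; rewrite /dg in_diagram //=.
by case: r l => [|r] [|l] //=; rewrite leq_cpart.
Qed.

Lemma dg_flip (b : color) (mu : partition_shape) (r l : nat) :
  dg (flip b) mu r l = dg b mu l r.
Proof. by rewrite /dg place_flip. Qed.

Lemma dg_gt0 (b : color) (mu : partition_shape) (r l : nat) :
  dg b mu r l -> 0 < r /\ 0 < l.
Proof. by rewrite dgE => /and3P[]. Qed.

(** The bound [bpart b] lowers one coordinate, the conjugate bound [bpart (flip b)] the other. *)
Lemma dg_leq (b : color) (mu : partition_shape) (r l r' l' : nat) :
  0 < r' <= r -> 0 < l' <= l -> dg b mu r l -> dg b mu r' l'.
Proof.
move=> /andP[r0 rr] /andP[l0 ll] rl.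
have : dg b mu r l' by move: rl; rewrite !dgE; lia.
by rewrite -!(dg_flip b) !dgE; lia.
Qed.

Lemma outer_corner_place (b : color) (mu : partition_shape) (r l : nat) :
  outer_corner mu (place b r l) <->
  [/\ 0 < r, 0 < l, ~~ dg b mu r l, r = 1 \/ dg b mu r.-1 l
    & l = 1 \/ dg b mu r l.-1].
Proof. by case: b; split=> -[]; split. Qed.

Definition allowed (b : color) (mu : partition_shape) : nat -> nat -> Prop :=
  if b is Black then allowed_row mu else allowed_col mu.

(** [bpart (flip b) mu l] is the length of line [l]; the position just past its end is an outer
    corner exactly when [l] is the first line or the preceding line is longer. *)
Lemma allowedP (b : color) (mu : partition_shape) (l r : nat) : 0 < l ->
  allowed b mu l r <-> dg b mu r l \/ outer_corner mu (place b r l).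
Proof.
move=> l0; have -> : allowed b mu l r =
  (1 <= r <= bpart (flip b) mu l \/ r = (bpart (flip b) mu l).+1 /\
   (l = 1 \/ bpart (flip b) mu l < bpart (flip b) mu l.-1)) by case: b.
rewrite outer_corner_place -!(dg_flip b) !dgE.
split=> [[rl|[-> rl]]|[|[r0 _ rl rl' rl'']]]; try lia.
by right; split; lia.
Qed.

Lemma card_diagram (mu : partition_shape) : #|` diagram mu| = sumn mu.
Proof.
rewrite /diagram card_fseq undup_id; last first.
  apply: allpairs_uniq_dep => [|i _|]; rewrite ?iota_uniq //.
  by move=> [i j] [i' j'] _ _ /= [-> ->].
rewrite size_allpairs_dep; congr sumn.
apply: (@eq_from_nth _ 0) => [|i]; first by rewrite size_map size_iota.
rewrite size_map size_iota => imu.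
by rewrite (nth_map 0) ?size_iota // nth_iota // /part.
Qed.

Lemma add_corner (mu : partition_shape) (c : cell) :
  outer_corner mu c -> exists nu, diagram nu = c |` diagram mu.
Proof.
case: c => i j ocij; case: (ocij) => i0 j0 _ _ _.
have /(outer_corner_place Black)[_ _] := ocij.
rewrite !dgE /= => Dij Di Dj; have {Dj} jE : j = (part mu i).+1 by lia.
(* [incr_nth] pads with zeros beyond the end of the list; since the corner is in the first row or
   below a non-empty row, no zero part appears. *)
have ile : i.-1 <= size mu.
  have [->//|Di'] : i = 1 \/ 0 < part mu i.-1 by lia.
  rewrite leqNgt; apply/negP => lt; move: Di'.
  by rewrite /part nth_default //; lia.
have [smu mu0] := andP (partsP mu).
have part_dec r : 0 < r -> part mu r.+1 <= part mu r.
  move=> r0; have [//|lt] := leqP (part mu r.+1) (part mu r).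
  have : dg Black mu r (part mu r.+1).
    by apply: (@dg_leq _ _ r.+1 (part mu r.+1)); rewrite ?dgE /=; lia.
  by rewrite dgE /=; lia.
have partS r : nth 0 mu r = part mu r.+1 by [].
have nuP : sorted geq (incr_nth mu i.-1) && (0 \notin incr_nth mu i.-1).
  apply/andP; split.
    apply/(sortedP 0) => r _; rewrite !nth_incr_nth /= !partS.
    have := part_dec r.+1 isT; case: eqP => [ir|_] /=; last by lia.
    have -> : (i.-1 == r) = false by lia.
    by move: Di jE; rewrite -ir prednK //; lia.
  apply/(nthP 0) => -[r]; rewrite size_incr_nth nth_incr_nth.
  case: eqP => //= ir rs nr0; have {}rs : r < size mu by case: ifP rs; lia.
  by move: (mem_nth 0 rs); rewrite -[nth _ _ _]add0n nr0 (negPf mu0).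
exists (PartitionShape nuP); apply/fsetP => -[r l].
rewrite in_fset1U !in_diagram /part /= nth_incr_nth xpair_eqE.
case: (posnP r) => [->|r0] /=; first by lia.
have -> : (i.-1 == r.-1) = (r == i) by lia.
case: eqP => [->|_] //=; rewrite jE; rewrite /part; lia.
Qed.

(** Counting leaves one cell of [nu] outside [mu]. Its upper and left neighbours lie in [nu] and
    differ from it, hence lie in [mu]. *)
Lemma covered_corner (mu nu : partition_shape) : covered mu nu ->
  exists2 c, outer_corner mu c & diagram nu = c |` diagram mu.
Proof.
move=> [munu]; rewrite -!card_diagram => cardnu.
have /cardfs1P[[i j] cE] : #|` diagram nu `\` diagram mu| == 1.
  by rewrite cardfsDS // cardnu subSnn.
have inD d : (d \in diagram nu) && (d \notin diagram mu) = (d == (i, j)).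
  by rewrite andbC -in_fsetD cE inE.
have nuE : diagram nu = (i, j) |` diagram mu.
  apply/fsetP => d; have := inD d; rewrite in_fset1U => <-.
  by have /implyP := fsubsetP munu d; case: (d \in _) (d \in _) => [] [].
exists (i, j) => //; have /andP[nuij muij] : 
  ((i, j) \in diagram nu) && ((i, j) \notin diagram mu) by rewrite inD.
have [i0 j0] := @dg_gt0 Black nu i j nuij.
have inmu r l : 0 < r <= i -> 0 < l <= j -> (r, l) != (i, j) ->
    (r, l) \in diagram mu.
  move=> ri lj ne; have := inD (r, l); rewrite (negPf ne).
  have -> : (r, l) \in diagram nu := dg_leq (b := Black) ri lj nuij.
  by move=> /negbFE.
split=> //.
- have [|i1] := ltnP 1 i; last by left; lia.
  by move=> ?; right; apply: inmu; rewrite ?xpair_eqE; lia.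
- have [|i1] := ltnP 1 j; last by left; lia.
  by move=> ?; right; apply: inmu; rewrite ?xpair_eqE; lia.
Qed.

Lemma corner_covered (mu nu : partition_shape) (c : cell) :
  c \notin diagram mu -> diagram nu = c |` diagram mu -> covered mu nu.
Proof.
move=> cmu nuE; split; first by rewrite /contained nuE fsubsetU1.
by rewrite -!card_diagram nuE cardfsU1 cmu.
Qed.

(** * Bounded tableaux *)

Definition cval (S : filling) (c : cell) : nat :=
  if S.[? c] is Some e then e.2 else 0.

(** The bound on an entry [t], read as membership in [la] of the cell moved [t] steps along its
    diagonal; in this form it is invariant under conjugation. *)
Definition fits_inside (la : partition_shape) (c : cell) (t : nat) : bool :=
  (c.1 + t, c.2 + t) \in diagram la.

Definition monotone (S : filling) : Prop :=
  forall b r l, place b r l \in domf S -> place b r.+1 l \in domf S ->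
    cval S (place b r l) <= cval S (place b r.+1 l).

Lemma fnd_domf (S : filling) (c : cell) : c \in domf S ->
  exists2 e, S.[? c] = Some e & cval S c = e.2.
Proof. by rewrite /cval; case: fndP => // cS _; exists S.[cS]. Qed.

Lemma domf_fnd (S : filling) (c : cell) (e : entry) :
  S.[? c] = Some e -> c \in domf S.
Proof. by case: fndP. Qed.

Lemma cval_set (S : filling) (c c' : cell) (e : entry) :
  cval S.[c <- e] c' = if c' == c then e.2 else cval S c'.
Proof. by rewrite /cval fnd_set; case: eqP. Qed.

Lemma cval_rem (S : filling) (c c' : cell) :
  c' != c -> cval S.[~ c] c' = cval S c'.
Proof. by rewrite /cval fnd_rem1 => ->. Qed.

Lemma fits_inside_place (b : color) (la : partition_shape) (r l t : nat) :
  fits_inside la (place b r l) t = dg b la (r + t) (l + t).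
Proof. by case: b. Qed.

Lemma monotone_leq (mu : partition_shape) (S : filling) (b : color)
    (r1 r2 l : nat) :
  domf S = diagram mu -> monotone S -> 0 < r1 <= r2 -> dg b mu r2 l ->
  cval S (place b r1 l) <= cval S (place b r2 l).
Proof.
move=> dS mS /andP[r0 r12]; rewrite -(subnKC r12).
elim: (r2 - r1) => [|n IHn]; first by rewrite addn0.
rewrite addnS => rl; have [_ l0] := dg_gt0 rl.
have rl' : dg b mu (r1 + n) l by apply: dg_leq rl; lia.
by apply: leq_trans (IHn rl') _; apply: mS; rewrite dS.
Qed.

Lemma boundedP (mu la : partition_shape) (S : filling) :
  bounded_tableaux mu la S <->
  [/\ domf S = diagram mu, monotone S
    & forall c, c \in diagram mu -> fits_inside la c (cval S c)].
Proof.
split=> [[[dS rS cS] bS]|[dS mS bS]].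
  split=> // [b r l|[i j]]; rewrite -?dS.
    move=> /fnd_domf[e1 E1 ->] /fnd_domf[e2 E2 ->].
    by case: b E1 E2 => E1 E2; [apply: cS E1 E2 | apply: rS E1 E2].
  move=> ijS; have [i0 j0] : 0 < i /\ 0 < j.
    by apply: (@dg_gt0 Black mu); rewrite /dg -dS.
  have [e E ->] := fnd_domf ijS.
  by rewrite /fits_inside in_diagram /= (bS _ _ _ E); lia.
have mono b r1 r2 l e1 e2 : r1 <= r2 -> S.[? place b r1 l] = Some e1 ->
    S.[? place b r2 l] = Some e2 -> e1.2 <= e2.2.
  move=> r12 E1 E2; move: (domf_fnd E1) (domf_fnd E2); rewrite dS => D1 D2.
  have := monotone_leq dS mS (r1 := r1) (r2 := r2) _ D2.
  rewrite /cval E1 E2; apply; rewrite r12 andbT.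
  by case: (dg_gt0 (D1 : dg b mu r1 l)).
split; first split=> //.
- by move=> i j1 j2 e1 e2; apply: (mono Red).
- by move=> j i1 i2 e1 e2; apply: (mono Black).
move=> i j e E; have := domf_fnd E; rewrite dS => /bS.
by rewrite /cval E /fits_inside in_diagram => /and3P[].
Qed.

Lemma bounded_leq (mu la : partition_shape) (S : filling) (b : color)
    (r1 l1 r2 l2 : nat) :
  bounded_tableaux mu la S -> 0 < r1 <= r2 -> 0 < l1 <= l2 ->
  dg b mu r2 l2 -> cval S (place b r1 l1) <= cval S (place b r2 l2).
Proof.
move=> /boundedP[dS mS _] r12 l12 D2.
have D1 : dg b mu r1 l2 by apply: dg_leq D2; lia.
apply: leq_trans (monotone_leq dS mS r12 D2).
rewrite -!(place_flip b); apply: (monotone_leq dS mS l12).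
by rewrite dg_flip.
Qed.

Lemma bounded_fits (mu la : partition_shape) (S : filling) (b : color)
    (r l : nat) :
  bounded_tableaux mu la S -> dg b mu r l ->
  dg b la (r + cval S (place b r l)) (l + cval S (place b r l)).
Proof. by move=> /boundedP[_ _ bS] /bS; rewrite fits_inside_place. Qed.

(** [la] contains the cell moved along its diagonal, hence also the cell itself. *)
Lemma bounded_contained (mu la : partition_shape) (S : filling) (b : color)
    (r l : nat) :
  bounded_tableaux mu la S -> dg b mu r l -> dg b la r l.
Proof.
move=> bS rl; have [r0 l0] := dg_gt0 rl; have := bounded_fits bS rl.
by apply: dg_leq; lia.
Qed.

Lemma monotone_set (S : filling) (b : color) (r l : nat) (e : entry) :
  (forall r l, place b r l \in domf S -> 0 < r /\ 0 < l) -> monotone S ->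
  (1 < r -> cval S (place b r.-1 l) <= e.2) ->
  (1 < l -> cval S (place b r l.-1) <= e.2) ->
  (place b r.+1 l \in domf S -> e.2 <= cval S (place b r.+1 l)) ->
  (place b r l.+1 \in domf S -> e.2 <= cval S (place b r l.+1)) ->
  monotone S.[place b r l <- e].
Proof.
move=> S0 mS r1 l1 rS lS b0 r0 l0; rewrite dom_setf !in_fset1U !cval_set.
have [->|->] := color_flip b b0.
  rewrite !place_eq; have := mS b r0 l0.
  have [->|nl] := eqVneq l0 l; rewrite ?(andbF, andbT) //=.
  case: (eqVneq r0 r) => [->|nr] /=; first by case: eqVneq => [|_] /=; [lia|move=> _ _ /rS].
  by case: eqP r1 => [<-|_] //= r1 _ /S0[r00 _] _; apply: r1.
rewrite !place_flip !place_eq; have := mS (flip b) r0 l0; rewrite !place_flip.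
have [->|nl] := eqVneq l0 r; rewrite ?(andbF, andbT) //=.
case: (eqVneq r0 l) => [->|nr] /=; first by case: eqVneq => [|_] /=; [lia|move=> _ _ /lS].
by case: eqP l1 => [<-|_] //= l1 _ /S0[_ r00] _; apply: l1.
Qed.

Lemma bounded_set (mu la : partition_shape) (S : filling) (b : color)
    (r l : nat) (e : entry) :
  bounded_tableaux mu la S -> dg b mu r l ->
  (1 < r -> cval S (place b r.-1 l) <= e.2) ->
  (1 < l -> cval S (place b r l.-1) <= e.2) ->
  (dg b mu r.+1 l -> e.2 <= cval S (place b r.+1 l)) ->
  (dg b mu r l.+1 -> e.2 <= cval S (place b r l.+1)) ->
  dg b la (r + e.2) (l + e.2) ->
  bounded_tableaux mu la S.[place b r l <- e].
Proof.
move=> /boundedP[dS mS bS] rl r1 l1 rS lS bd; apply/boundedP; split.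
- by rewrite dom_setf mem_fset1U // dS.
- by apply: monotone_set; rewrite ?dS // => r' l' /dg_gt0.
move=> c /bS; rewrite cval_set; case: eqP => // ->.
by rewrite !fits_inside_place.
Qed.

(** The effect of a bump: a smaller value stays below the later neighbours and shortens the diagonal
    move, so the bound persists. *)
Lemma bounded_lower (mu la : partition_shape) (S : filling) (b : color)
    (r l : nat) (e : entry) :
  bounded_tableaux mu la S -> dg b mu r l ->
  (1 < r -> cval S (place b r.-1 l) <= e.2) ->
  (1 < l -> cval S (place b r l.-1) <= e.2) ->
  e.2 <= cval S (place b r l) ->
  bounded_tableaux mu la S.[place b r l <- e].
Proof.
move=> bS rl r1 l1 ele; have [r0 l0] := dg_gt0 rl.
apply: bounded_set => // [D|D|].
- by apply: leq_trans ele _; apply: bounded_leq bS _ _ D; lia.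
- by apply: leq_trans ele _; apply: bounded_leq bS _ _ D; lia.
by apply: dg_leq (bounded_fits bS rl); lia.
Qed.

(** The effect of undoing a bump: the earlier neighbours stay below a larger value, so the later
    neighbours and the bound remain to be checked. *)
Lemma bounded_raise (mu la : partition_shape) (S : filling) (b : color)
    (r l : nat) (e : entry) :
  bounded_tableaux mu la S -> dg b mu r l ->
  cval S (place b r l) <= e.2 ->
  (dg b mu r.+1 l -> e.2 <= cval S (place b r.+1 l)) ->
  (dg b mu r l.+1 -> e.2 <= cval S (place b r l.+1)) ->
  dg b la (r + e.2) (l + e.2) ->
  bounded_tableaux mu la S.[place b r l <- e].
Proof.
move=> bS rl ele rS lS bd; have [r0 l0] := dg_gt0 rl.
apply: bounded_set => // D.
- by apply: leq_trans _ ele; apply: bounded_leq bS _ _ rl; lia.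
- by apply: leq_trans _ ele; apply: bounded_leq bS _ _ rl; lia.
Qed.

(** A corner has no later neighbour in [mu], so only the earlier ones constrain the new entry. That
    the new shape lies in [la] follows from boundedness. *)
Lemma covering_add (mu la : partition_shape) (S : filling) (b : color)
    (r l : nat) (e : entry) :
  bounded_tableaux mu la S -> outer_corner mu (place b r l) ->
  (1 < r -> cval S (place b r.-1 l) <= e.2) ->
  (1 < l -> cval S (place b r l.-1) <= e.2) ->
  dg b la (r + e.2) (l + e.2) ->
  covering_tableaux mu la S.[place b r l <- e].
Proof.
move=> bS oc r1 l1 bd; have [nu nuE] := add_corner oc.
have /outer_corner_place[r0 l0 nrl _ _] := oc.
have nD r' l' : dg b mu r' l' -> r <= r' -> l <= l' -> False.
  by move=> D rr ll; move/negP: nrl; apply; apply: dg_leq D; lia.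
have bnu : bounded_tableaux nu la S.[place b r l <- e].
  move/boundedP: bS => [dS mS bS]; apply/boundedP; split.
  - by rewrite dom_setf dS.
  - apply: monotone_set => // [r' l'|D|D].
    + by rewrite dS => /dg_gt0.
    + by rewrite dS in D; case: (nD _ _ D).
    + by rewrite dS in D; case: (nD _ _ D).
  move=> c; rewrite nuE in_fset1U cval_set; case: eqP => [-> _|_ /bS //].
  by rewrite fits_inside_place.
exists nu; split=> //; first by apply: corner_covered nuE.
apply/fsubsetP => -[i j] nuij.
by apply: (bounded_contained (b := Black) bnu).
Qed.

Lemma covering_domf (mu la : partition_shape) (S : filling) :
  covering_tableaux mu la S ->
  exists2 c, outer_corner mu c & domf S = c |` diagram mu.
Proof.
by move=> [nu [/covered_corner[c oc nuE] _ [[dS _ _] _]]]; exists c; rewrite ?dS.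
Qed.

Lemma covering_fits (mu la : partition_shape) (S : filling) (c : cell) :
  covering_tableaux mu la S -> c \in domf S -> fits_inside la c (cval S c).
Proof. by move=> [nu [_ _ /boundedP[dS _ bS]]]; rewrite dS => /bS. Qed.

(** [b] is taken to be the color of the removed entry, so that [l] is the line into which this entry
    was inserted. *)
Lemma covering_remove (mu la : partition_shape) (S : filling) :
  covering_tableaux mu la S ->
  exists b r l t, [/\ outer_corner mu (place b r l),
    S.[? place b r l] = Some (b, t),
    bounded_tableaux mu la S.[~ place b r l] /\ dg b la (r + t) (l + t),
    1 < r -> cval S.[~ place b r l] (place b r.-1 l) <= t
    & 1 < l -> cval S.[~ place b r l] (place b r l.-1) <= t].
Proof.
move=> covS; have [c oc dS] := covering_domf covS.
have cS : c \in domf S by rewrite dS fset1U1.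
have [[b t] E tE] := fnd_domf cS.
have [nu [_ _ bS]] := covS; have [dS' mS fS] := (boundedP nu la S).1 bS.
rewrite -(placeK b c) in oc cS E tE dS *.
exists b, (pos b c), (line b c), t.
move: (pos b c) (line b c) oc cS E tE dS => r l {c} oc cS E /= tE dS.
have /outer_corner_place[r0 l0 nrl _ _] := oc.
split=> //.
- split; last first.
    by have := fS _; rewrite -dS' => /(_ _ cS); rewrite fits_inside_place tE.
  apply/boundedP; split.
  + rewrite domf_rem dS; apply/fsetP => d; rewrite in_fsetD in_fset1 in_fset1U.
    by case: eqP => //= ->; apply/esym/negbTE.
  + move=> b' r' l'; rewrite !mem_remf1 => /andP[n1 D1] /andP[n2 D2].
    by rewrite !cval_rem //; apply: mS.
  move=> d Dd; rewrite cval_rem; last by apply: contraNneq nrl; rewrite /dg => <-.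
  by apply: fS; rewrite -dS' dS in_fset1U Dd orbT.
- move=> r1; rewrite cval_rem ?place_eq; last by lia.
  by rewrite -tE; apply: bounded_leq bS _ _ _; rewrite /dg -?dS' //; lia.
- move=> l1; rewrite cval_rem ?place_eq; last by lia.
  by rewrite -tE; apply: bounded_leq bS _ _ _; rewrite /dg -?dS' //; lia.
Qed.

(** * Placements *)

Definition line_increasing (b : color) : filling -> nat -> Prop :=
  if b is Black then col_weakly_increasing else row_weakly_increasing.

Lemma line_increasingP (b : color) (S : filling) (l : nat) :
  line_increasing b S l <->
  forall r1 r2 e1 e2, r1 <= r2 -> S.[? place b r1 l] = Some e1 ->
    S.[? place b r2 l] = Some e2 -> e1.2 <= e2.2.
Proof. by case: b. Qed.

Definition fits_in_line (b : color) (mu : partition_shape) (S : filling)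
    (k l r : nat) : Prop :=
  [/\ allowed b mu l r, r <= k
    & line_increasing b S.[place b r l <- (b, k - r)] l].

Lemma placementP (mu : partition_shape) (S : filling) (c c' : cell)
    (b : color) (k : nat) (e : entry) :
  placement mu S c (bvar b k) c' e <->
  exists r, [/\ c' = place b r (line b c).+1, e = (b, k - r)
    & largest (fits_in_line b mu S k (line b c).+1) r].
Proof.
split.
  case: b => /= H; inversion H; subst.
    by exists i'.
  by exists j'.
case: c => i j; case: b => -[r [-> -> H]] /=.
  by apply: placement_black.
by apply: placement_red.
Qed.

Lemma largest_unique (P : nat -> Prop) (m n : nat) :
  largest P m -> largest P n -> m = n.
Proof.
by move=> [Pm mP] [Pn nP]; apply/eqP; rewrite eqn_leq mP // nP.
Qed.

Lemma placement_det (mu : partition_shape) (S : filling) (c : cell) (w : var)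
    (c1 c2 : cell) (e1 e2 : entry) :
  placement mu S c w c1 e1 -> placement mu S c w c2 e2 ->
  c1 = c2 /\ e1 = e2.
Proof.
have [b [k ->]] := bvarP w.
move=> /placementP[r1 [-> -> L1]] /placementP[r2 [-> -> L2]].
by rewrite (largest_unique L1 L2).
Qed.

Lemma placement_repr (mu : partition_shape) (S : filling) (c : cell) (w : var)
    (c' : cell) (e : entry) :
  placement mu S c w c' e -> repr_var c' e = w.
Proof.
have [b [k ->]] := bvarP w => /placementP[r [-> -> [[_ rk _] _]]].
by rewrite repr_varE pos_place subnKC.
Qed.

(* Along a line, [r + cval S (place b r l)] is strictly increasing in [r]; a
   variable of index [k] goes to the first position where this is at least [k]. *)
Definition insertion_point (mu : partition_shape) (S : filling) (b : color)
    (k l r : nat) : Prop :=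
  [/\ dg b mu r l \/ outer_corner mu (place b r l), r <= k,
      1 < r -> r.-1 + cval S (place b r.-1 l) < k
    & dg b mu r l -> k <= r + cval S (place b r l)].

Lemma insertion_point_gt0 (mu : partition_shape) (S : filling) (b : color)
    (k l r : nat) : insertion_point mu S b k l r -> 0 < r /\ 0 < l.
Proof. by move=> [[/dg_gt0|/outer_corner_place[]]]. Qed.

(** A position [m] beyond [r] would put [k - m] after an entry that is at least [k - r], hence
    larger; so the largest fitting position is the first one whose index reaches [k]. *)
Lemma insertion_point_placement (mu la : partition_shape) (S : filling)
    (b : color) (c : cell) (k r : nat) :
  bounded_tableaux mu la S ->
  insertion_point mu S b k (line b c).+1 r ->
  placement mu S c (bvar b k) (place b r (line b c).+1) (b, k - r).
Proof.
set l := (line b c).+1 => bS ip; have [r0 l0] := insertion_point_gt0 ip.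
have [dS _ _] := (boundedP _ _ _).1 bS.
case: ip => Drl rk pred next; apply/placementP; exists r; split=> //.
have inD r' e : S.[? place b r' l] = Some e ->
    [/\ dg b mu r' l, 0 < r' & cval S (place b r' l) = e.2].
  move=> E; have := domf_fnd E; rewrite dS => D.
  by rewrite /cval E; case: (dg_gt0 D).
split.
  split=> //; first exact/allowedP.
  apply/line_increasingP => r1 r2 e1 e2 r12.
  rewrite !fnd_set !place_eq !eqxx !andbT.
  case: (eqVneq r1 r) => [r1E [<-]|n1 /inD[D1 r10 <-]];
    case: (eqVneq r2 r) => [r2E [<-] //|n2 /inD[D2 r20 <-]] /=.
  - have D : dg b mu r l by apply: dg_leq D2; lia.
    apply: leq_trans (_ : cval S (place b r l) <= _); first by have := next D; lia.
    by apply: bounded_leq bS _ _ D2; lia.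
  - have r1' : 1 < r by lia.
    have D : dg b mu r.-1 l.
      case: Drl => [|/outer_corner_place[_ _ _ [?|//] _]]; last by lia.
      by apply: dg_leq; lia.
    apply: leq_trans (_ : cval S (place b r.-1 l) <= _).
      by apply: bounded_leq bS _ _ D; lia.
    by have := pred r1'; lia.
  - by apply: bounded_leq bS _ _ D2; lia.
move=> m [/(allowedP _ _ _ l0) Dm mk /line_increasingP inc].
rewrite leqNgt; apply/negP => rm.
have D : dg b mu r l.
  have : dg b mu m.-1 l.
    case: Dm => [D|/outer_corner_place[_ _ _ [?|//] _]]; last by lia.
    by apply: dg_leq D; lia.
  by apply: dg_leq; lia.
have := D; rewrite /dg -dS => /fnd_domf[e E tE].
have := inc r m e (b, k - m) (ltnW rm).
rewrite !fnd_set !place_eq !eqxx !andbT ltn_eqF // => /(_ E erefl) /=.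
by have := next D; rewrite tE; lia.
Qed.

(** * The states of the insertion process *)

Definition state : Type := filling * cell * var.

(* A variable of color [b] and index [k] has just been bumped out of the cell
   [place b r l]: the tableau remains bounded when it is put back, and its value
   is at least that of the entry which replaced it. *)
Definition bumped (mu la : partition_shape) (S : filling) (b : color)
    (k r l : nat) : Prop :=
  [/\ dg b mu r l, r + cval S (place b r l) <= k,
      dg b mu r l.+1 -> k <= r + cval S (place b r l.+1),
      dg b mu r.+1 l -> k <= r + cval S (place b r.+1 l)
    & dg b la k (l + k - r)].

(** The invariant of the process. At the origin it only records that part [k] of [la] (or of its
    conjugate) is non-zero, which holds for admissible variables and after restarts, and bounds the
    index. *)
Definition valid_state (mu la : partition_shape) (st : state) : Prop :=
  let: (T, c, w) := st in
  bounded_tableaux mu la T /\ exists b k, w = bvar b k /\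
    (c = (0, 0) /\ dg b la k 1 \/ bumped mu la T b k (pos b c) (line b c)).

Lemma valid_bvar (mu la : partition_shape) (S : filling) (c : cell)
    (b : color) (k : nat) :
  valid_state mu la (S, c, bvar b k) ->
  c = (0, 0) /\ dg b la k 1 \/ bumped mu la S b k (pos b c) (line b c).
Proof. by move=> [_ [b' [k' [/bvar_inj[<- <-]]]]]. Qed.

Lemma valid_index (mu la : partition_shape) (S : filling) (c : cell)
    (b : color) (k : nat) :
  valid_state mu la (S, c, bvar b k) -> dg b la k 1.
Proof.
move=> /valid_bvar[[]//|[_ _ _ _ D]]; have [k0 l0] := dg_gt0 D.
by apply: dg_leq D; lia.
Qed.

(** The insertion point is found by minimality. The position of a bumped variable in its old line
    already qualifies in the next one, whence [r <= pos b c]. *)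
Lemma valid_insertion_point (mu la : partition_shape) (S : filling) (c : cell)
    (b : color) (k : nat) :
  valid_state mu la (S, c, bvar b k) ->
  exists2 r, insertion_point mu S b k (line b c).+1 r
    & c = (0, 0) \/ r <= pos b c.
Proof.
move=> vS; have [k0 _] := dg_gt0 (valid_index vS).
have [bS _] := vS; set l := (line b c).+1.
pose P r := (0 < r) && (~~ dg b mu r l || (k <= r + cval S (place b r l))).
have exP : exists r, P r.
  (* The position just past the end of line [l]. *)
  exists (bpart (flip b) mu l).+1.
  by rewrite /P -dg_flip dgE ltnn !andbF.
case: (ex_minnP exP) => r /andP[r0 Pr] minr.
have pred : 1 < r -> dg b mu r.-1 l && (r.-1 + cval S (place b r.-1 l) < k).
  by move=> r1; have := contraNN (minr r.-1); rewrite /P; lia.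
have rpos : c = (0, 0) \/ dg b mu (pos b c) (line b c) /\ r <= pos b c.
  have [[-> _]|[D le nextl _ _]] := valid_bvar vS; first by left.
  right; split=> //; apply: minr; rewrite /P (dg_gt0 D).1 /=.
  by case: (boolP (dg _ _ _ _)) => //= /nextl.
exists r; last by case: rpos => [|[]]; [left|right].
split.
- have [D|nD] := boolP (dg b mu r l); [by left | right].
  apply/outer_corner_place; split=> //.
    have [|r1] := ltnP 1 r; last by left; lia.
    by move=> /pred /andP[]; right.
  rewrite /l /=; case: rpos => [->|[D rle]]; first by left; case: (b).
  by have := dg_gt0 D; right; apply: dg_leq D; lia.
- have [/pred|] := ltnP 1 r; lia.
- by move=> /pred /andP[].
- by move=> D; move: Pr; rewrite D.
Qed.

(** Since [r <= pos b c], the left neighbour is at most the entry now in [c], which is at most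
    [k - pos b c], hence at most [k - r]. *)
Lemma insertion_point_left (mu la : partition_shape) (S : filling) (c : cell)
    (b : color) (k r : nat) :
  valid_state mu la (S, c, bvar b k) -> c = (0, 0) \/ r <= pos b c -> 0 < r ->
  1 < (line b c).+1 -> cval S (place b r (line b c)) <= k - r.
Proof.
move=> vS rc r0; have [bS _] := vS.
have [[-> _]|[D le _ _ _]] := valid_bvar vS; first by case: (b).
case: rc => [cE|rle]; first by move: D; rewrite cE => /dg_gt0[]; case: (b).
move=> l0; apply: leq_trans (_ : cval S (place b (pos b c) (line b c)) <= _).
  by apply: bounded_leq bS _ _ D; lia.
lia.
Qed.

(* Removing the entry at a corner where the bound fails, and inserting the
   removed variable again, amounts to restarting with the same filling. *)
Inductive step (mu la : partition_shape) : state -> state -> Prop :=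
| step_bump (S : filling) (c : cell) (w : var) (c' : cell) (e old : entry) :
    placement mu S c w c' e -> c' \in diagram mu -> S.[? c'] = Some old ->
    step mu la (S, c, w) (S.[c' <- e], c', repr_var c' old)
| step_restart (S : filling) (c : cell) (w : var) (c' : cell) (e : entry) :
    placement mu S c w c' e -> outer_corner mu c' ->
    ~~ fits_inside la c' e.2 -> step mu la (S, c, w) (S, (0, 0), w).

Inductive output (mu la : partition_shape) : state -> filling -> Prop :=
| output_intro (S : filling) (c : cell) (w : var) (c' : cell) (e : entry) :
    placement mu S c w c' e -> outer_corner mu c' ->
    fits_inside la c' e.2 -> output mu la (S, c, w) S.[c' <- e].

Definition initial (mu la : partition_shape) (st : state) : Prop :=
  [/\ bounded_tableaux mu la st.1.1, st.1.2 = (0, 0)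
    & admissible_vars mu la st.2].

Lemma outer_corner_notin (mu : partition_shape) (c : cell) :
  outer_corner mu c -> c \notin diagram mu.
Proof. by case: c => i j []. Qed.

Lemma stepP (mu la : partition_shape) (S S' : filling) (c c' : cell)
    (w w' : var) :
  step mu la (S, c, w) (S', c', w') ->
  (exists e old, [/\ placement mu S c w c' e, c' \in diagram mu,
     S.[? c'] = Some old, S' = S.[c' <- e] & w' = repr_var c' old]) \/
  (exists d e, [/\ placement mu S c w d e, outer_corner mu d,
     ~~ fits_inside la d e.2 & (S', c', w') = (S, (0, 0), w)]).
Proof.
move=> H; inversion H as [? ? ? ? e old|? ? ? d e]; subst.
  by left; exists e, old.
by right; exists d, e.
Qed.

Lemma outputP (mu la : partition_shape) (S S' : filling) (c : cell) (w : var) :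
  output mu la (S, c, w) S' ->
  exists d e, [/\ placement mu S c w d e, outer_corner mu d,
    fits_inside la d e.2 & S' = S.[d <- e]].
Proof. by move=> H; inversion H as [? ? ? d e]; subst; exists d, e. Qed.

Lemma valid_bump (mu la : partition_shape) (S : filling) (c : cell) (b : color)
    (k r : nat) (old : entry) :
  let c' := place b r (line b c).+1 in
  valid_state mu la (S, c, bvar b k) ->
  insertion_point mu S b k (line b c).+1 r -> c = (0, 0) \/ r <= pos b c ->
  c' \in diagram mu -> S.[? c'] = Some old ->
  valid_state mu la (S.[c' <- (b, k - r)], c', repr_var c' old).
Proof.
move=> c' vS ip rc c'mu E; have [bS _] := vS.
have [r0 l0] := insertion_point_gt0 ip.
case: ip => _ rk pred next.
have vE : cval S c' = old.2 by rewrite /cval E.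
have kr : k - r <= old.2 by have := next c'mu; rewrite vE; lia.
split.
  apply: bounded_lower => //=; last by rewrite -/c' vE.
    by move=> r1; have := pred r1; lia.
  exact: insertion_point_left vS rc r0.
case: old E vE kr => b' t' E vE kr; exists b', (pos b' c' + t').
split; [by rewrite repr_varE | right]; move: vE kr => /= vE kr.
(* The bumped entry may have the other color, so the cell is rewritten in the coordinates of
   [b']. *)
rewrite -(placeK b' c') in c'mu vE *; rewrite !pos_place !line_place.
move: (pos b' c') (line b' c') c'mu vE => r' l' {E} D vE.
split=> //; rewrite ?cval_set ?place_eq ?eqxx /=; try lia.
- rewrite (_ : l'.+1 == l' = false) ?andbF; last by lia.
  move=> D'; rewrite leq_add2l -vE; apply: bounded_leq bS _ _ D' => //;
  by have := dg_gt0 D; lia.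
- rewrite (_ : r'.+1 == r' = false) /=; last by lia.
  move=> D'; rewrite leq_add2l -vE; apply: bounded_leq bS _ _ D' => //;
  by have := dg_gt0 D; lia.
- have := bounded_fits bS D; rewrite vE.
  by rewrite (_ : l' + (r' + t') - r' = l' + t') //; lia.
Qed.

Lemma valid_step (mu la : partition_shape) (st : state) :
  valid_state mu la st ->
  (exists2 st', valid_state mu la st' & step mu la st st') \/
  (exists S, output mu la st S).
Proof.
case: st => -[S c] w; have [b [k ->]] := bvarP w => vS; have [bS _] := vS.
have [r ip rc] := valid_insertion_point vS.
have pl := insertion_point_placement bS ip.
have [D|oc] : dg b mu r (line b c).+1 \/
    outer_corner mu (place b r (line b c).+1) by case: ip.
  have [dS _ _] := (boundedP _ _ _).1 bS.
  have [|old E _] := @fnd_domf S (place b r (line b c).+1); first by rewrite dS.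
  left; eexists; last exact: step_bump pl D E.
  exact: valid_bump.
have [F|nF] := boolP (fits_inside la (place b r (line b c).+1) (k - r)).
  by right; eexists; apply: output_intro pl oc F.
left; eexists; last exact: step_restart pl oc nF.
split=> //; exists b, k; split=> //; left; split=> //; exact: valid_index vS.
Qed.

Lemma placement_insertion_point (mu la : partition_shape) (S : filling)
    (c c' : cell) (b : color) (k : nat) (e : entry) :
  valid_state mu la (S, c, bvar b k) -> placement mu S c (bvar b k) c' e ->
  exists r, [/\ c' = place b r (line b c).+1, e = (b, k - r),
    insertion_point mu S b k (line b c).+1 r & c = (0, 0) \/ r <= pos b c].
Proof.
move=> vS pl; have [r ip rc] := valid_insertion_point vS.
have [-> ->] := placement_det pl (insertion_point_placement vS.1 ip).
by exists r.
Qed.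

Lemma output_covering (mu la : partition_shape) (st : state) (S' : filling) :
  valid_state mu la st -> output mu la st S' -> covering_tableaux mu la S'.
Proof.
case: st => -[S c] w; have [b [k ->]] := bvarP w => vS /outputP[c' [e []]].
move=> /(placement_insertion_point vS)[r [-> -> ip rc]] oc.
rewrite fits_inside_place => F ->.
have [r0 l0] := insertion_point_gt0 ip; case: ip => _ rk pred _.
apply: covering_add => //=; first exact: vS.1.
  by move=> r1; have := pred r1; lia.
exact: insertion_point_left vS rc r0.
Qed.

(** * Determinism and injectivity of steps and outputs *)

Lemma step_det (mu la : partition_shape) (st st1 st2 : state) :
  step mu la st st1 -> step mu la st st2 -> st1 = st2.
Proof.
case: st st1 st2 => -[S c] w [[S1 c1] w1] [[S2 c2] w2].
move=> /stepP[[e1 [old1 [pl1 D1 E1 -> ->]]]|[d1 [e1 [pl1 oc1 _ ->]]]] /stepP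
  [[e2 [old2 [pl2 D2 E2 -> ->]]]|[d2 [e2 [pl2 oc2 _ ->]]]] //.
- have [cE ->] := placement_det pl1 pl2; move: E1; rewrite cE E2.
  by move=> [->].
- have [cE _] := placement_det pl1 pl2; move: D1; rewrite cE.
  by move/negP: (outer_corner_notin oc2).
- have [cE _] := placement_det pl1 pl2; move: D2; rewrite -cE.
  by move/negP: (outer_corner_notin oc1).
Qed.

Lemma output_step (mu la : partition_shape) (st st' : state) (S' : filling) :
  output mu la st S' -> ~ step mu la st st'.
Proof.
case: st st' => -[S c] w [[S2 c2] w2] /outputP[d1 [e1 [pl1 oc1 F _]]].
move=> /stepP[[e2 [old2 [pl2 D2 _ _ _]]]|[d2 [e2 [pl2 oc2 nF _]]]];
  have [cE eE] := placement_det pl1 pl2.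
  by move: D2; rewrite -cE; apply/negP/outer_corner_notin.
by move: nF; rewrite -cE -eE F.
Qed.

Lemma valid_origin (mu la : partition_shape) (S : filling) (c : cell)
    (b : color) (k : nat) :
  valid_state mu la (S, c, bvar b k) -> line b c = 0 -> c = (0, 0).
Proof. by move=> /valid_bvar[[]//|[/dg_gt0[_ l0] _ _ _ _]] l0'; lia. Qed.

(* The position of a bumped variable is the last one of its line where
   [r + cval S (place b r l)] is at most its index. *)
Lemma bumped_unique (mu la : partition_shape) (S : filling) (b : color)
    (k r1 r2 l : nat) :
  bounded_tableaux mu la S ->
  bumped mu la S b k r1 l -> bumped mu la S b k r2 l -> r1 = r2.
Proof.
move=> bS; wlog r12 : r1 r2 / r1 < r2 => [IH B1 B2|].
  by have [lt|gt|//] := ltngtP r1 r2; [|apply/esym]; apply: IH.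
move=> [D1 _ _ next _] [D2 le2 _ _ _]; have [r10 l0] := dg_gt0 D1.
have D : dg b mu r1.+1 l by apply: dg_leq D2; lia.
have := bounded_leq bS (r1 := r1.+1) (l1 := l) _ _ D2.
by have := next D; lia.
Qed.

Lemma placement_pred (mu la : partition_shape) (S : filling)
    (c1 c2 c' : cell) (w : var) (e : entry) :
  valid_state mu la (S, c1, w) -> valid_state mu la (S, c2, w) ->
  placement mu S c1 w c' e -> placement mu S c2 w c' e -> c1 = c2.
Proof.
have [b [k ->]] := bvarP w => v1 v2.
move=> /placementP[r1 [-> _ _]] /placementP[r2 [/eqP + _ _]].
rewrite place_eq eqSS => /andP[_ /eqP lE].
have [l0|l0] := posnP (line b c1).
  by rewrite (valid_origin v1 l0) (valid_origin v2) // -lE.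
have [[c1E _]|B1] := valid_bvar v1; first by move: l0; rewrite c1E; case: (b).
have [[c2E _]|B2] := valid_bvar v2.
  by move: l0; rewrite lE c2E; case: (b).
rewrite -(placeK b c1) -(placeK b c2) lE.
by congr place; apply: bumped_unique v1.1 B1 _; rewrite lE.
Qed.

(* At a corner where the bound fails, the inserted variable still satisfied it
   in the cell that it was bumped from; so it cannot fail at a lower corner. *)
Lemma failing_corner (mu la : partition_shape) (S : filling) (c2 : cell)
    (b : color) (k r1 l1 : nat) :
  valid_state mu la (S, c2, bvar b k) ->
  outer_corner mu (place b r1 l1) -> r1 <= k ->
  ~~ dg b la (r1 + (k - r1)) (l1 + (k - r1)) -> (line b c2).+1 <= l1.
Proof.
move=> v2 /outer_corner_place[r10 l10 nD1 _ _] rk nF.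
rewrite leqNgt; apply/negP => l12.
have [[cE _]|[D2 le _ _ F]] := valid_bvar v2.
  by move: l12; rewrite cE; case: (b) => /=; lia.
have r12 : pos b c2 < r1.
  by rewrite ltnNge; apply: contraNN nD1 => le'; apply: dg_leq D2; lia.
by move/negP: nF; apply; apply: dg_leq F; lia.
Qed.

(** The cell [(0, 0)] lies in no diagram, so the current cell tells restarts from bumps. A bump is
    undone by putting the old entry back. For two restarts, [failing_corner] used both ways makes
    the lines of the corners equal. *)
Lemma step_inj (mu la : partition_shape) (st1 st2 st : state) :
  valid_state mu la st1 -> valid_state mu la st2 ->
  step mu la st1 st -> step mu la st2 st -> st1 = st2.
Proof.
case: st1 st2 st => -[S1 c1] w1 [[S2 c2] w2] [[S c'] w] v1 v2.
move=> /stepP[[e1 [old1 [pl1 D1 E1 -> ->]]]|[d1 [e1 [pl1 oc1 nF1 [-> -> ->]]]]].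
  case/stepP=> [[e2 [old2 [pl2 _ E2 eqS /repr_var_inj oldE]]]|].
    have eE : e1 = e2.
      have := congr1 (fun f : filling => f.[? c']) eqS.
      by rewrite !fnd_set eqxx => -[].
    have SE : S1 = S2.
      apply/fmapP => d; have [->|nd] := eqVneq d c'; first by rewrite E1 E2 oldE.
      have := congr1 (fun f : filling => f.[? d]) eqS.
      by rewrite !fnd_set (negPf nd).
    have wE : w1 = w2.
      by rewrite -(placement_repr pl1) -(placement_repr pl2) eE.
    by rewrite {}SE {}wE {}eE in v1 pl1 *; rewrite (placement_pred v1 v2 pl1 pl2).
  by move=> [d2 [e2 [_ _ _ [_ cE _]]]]; move: D1; rewrite cE in_diagram.
case/stepP=> [[e2 [old2 [_ D2 _ _ _]]]|]; first by move: D2; rewrite in_diagram.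
move=> [d2 [e2 [pl2 oc2 nF2 [SE wE]]]]; rewrite -{}SE -{}wE in v2 pl2 *.
have [b [k wE]] := bvarP w1; rewrite {}wE in v1 v2 pl1 pl2 *.
have [r1 [d1E e1E [_ rk1 _ _] _]] := placement_insertion_point v1 pl1.
have [r2 [d2E e2E [_ rk2 _ _] _]] := placement_insertion_point v2 pl2.
subst; move: nF1 nF2; rewrite !fits_inside_place /= => nF1 nF2.
have lE : (line b c1).+1 = (line b c2).+1.
  apply/eqP; rewrite eqn_leq (failing_corner v1 oc2) //.
  by rewrite (failing_corner v2 oc1).
have rE : r1 = r2.
  move/outer_corner_place: oc1; move/outer_corner_place: oc2; rewrite lE.
  move=> [r20 l0 nD2 p2 _] [r10 _ nD1 p1 _].
  (* A line has at most one outer corner. *)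
  have aux r r' : 0 < r -> ~~ dg b mu r (line b c2).+1 ->
      r' = 1 \/ dg b mu r'.-1 (line b c2).+1 -> r' <= r.
    move=> r0 nD [-> //|D]; rewrite leqNgt; apply: contraNN nD => lt.
    by apply: dg_leq D; lia.
  by apply/eqP; rewrite eqn_leq (aux r2 r1) ?(aux r1 r2).
rewrite -{}rE -{}lE in pl2.
by rewrite (placement_pred v1 v2 pl1 pl2).
Qed.

(** The cell outside [mu] and its entry can be read off the output; removing them recovers the
    filling, and the entry represents the inserted variable. *)
Lemma output_inj (mu la : partition_shape) (st1 st2 : state) (S' : filling) :
  valid_state mu la st1 -> valid_state mu la st2 ->
  output mu la st1 S' -> output mu la st2 S' -> st1 = st2.
Proof.
case: st1 st2 => -[S1 c1] w1 [[S2 c2] w2] v1 v2.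
move=> /outputP[d1 [e1 [pl1 oc1 _ ->]]] /outputP[d2 [e2 [pl2 oc2 _ eqS]]].
have nd1 := outer_corner_notin oc1; have nd2 := outer_corner_notin oc2.
have [[dS1 _ _] _] := v1.1; have [[dS2 _ _] _] := v2.1.
have dE : d2 = d1.
  have := congr1 (fun f : filling => domf f) eqS; rewrite !dom_setf dS1 dS2.
  move/fsetP/(_ d2); rewrite !in_fset1U eqxx (negPf nd2) orbF.
  by move/eqP.
rewrite {}dE in pl2 nd2 eqS.
have eE : e1 = e2.
  by have := congr1 (fun f : filling => f.[? d1]) eqS; rewrite !fnd_set eqxx => -[].
have SE : S1 = S2.
  apply: (@setf_inj _ _ _ _ d1 e1); [by rewrite -dS1 in nd1 | by rewrite -dS2 in nd2 |].
  by rewrite eqS eE.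
have wE : w1 = w2.
  by rewrite -(placement_repr pl1) -(placement_repr pl2) eE.
by rewrite {}SE {}wE {}eE in v1 pl1 *; rewrite (placement_pred v1 v2 pl1 pl2).
Qed.

(** * Initial states and admissible variables *)

Lemma admissible_bvar (mu la : partition_shape) (b : color) (k : nat) :
  admissible_vars mu la (bvar b k) <->
  1 <= k /\ forall m, 1 <= m -> bpart b la k + m <> bpart b mu m + k.
Proof.
case: b => /=; split=> -[k0 H]; split=> // m m0; have := H m m0; lia.
Qed.

(** Admissibility at [m = k] gives different parts [k] of [la] and [mu]; as [mu] lies in [la], part
    [k] of [la] cannot be zero. *)
Lemma initial_valid (mu la : partition_shape) (st : state) :
  initial mu la st -> valid_state mu la st.
Proof.
case: st => -[S c] w [/= bS ->]; have [b [k ->]] := bvarP w.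
move=> /admissible_bvar[k0 H]; split=> //; exists b, k; split=> //; left.
split=> //; have := @bounded_contained _ _ _ b k 1 bS; have := H k k0.
by rewrite !dgE; lia.
Qed.

(* The bound holds at the cell [place b i l.-1] left by the variable and fails
   at the corner [place b r l]; this places [la_k - k] among the numbers
   [mu_m - m] for [r <= m <= i], where all parts [mu_m] are equal to [l.-1]. *)
Lemma restart_not_admissible (mu la : partition_shape) (S : filling)
    (c c' : cell) (w : var) (e : entry) :
  valid_state mu la (S, c, w) -> placement mu S c w c' e ->
  outer_corner mu c' -> ~~ fits_inside la c' e.2 -> ~ admissible_vars mu la w.
Proof.
have [b [k ->]] := bvarP w => vS pl.
have [r [-> -> [_ rk _ _] rc]] := placement_insertion_point vS pl.
rewrite fits_inside_place subnKC //= => /outer_corner_place[r0 l0 nD _ _] nF.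
have Dk := valid_index vS.
move=> /admissible_bvar[k0 H].
have bnd : bpart b la k < (line b c).+1 + (k - r) by move: nF; rewrite dgE; lia.
have [m [rm Dm mE]] : exists m, [/\ r <= m, 0 < line b c -> dg b mu m (line b c)
    & bpart b la k + m = line b c + k].
  exists (line b c + k - bpart b la k); split; try lia.
  move=> lc; have [[cE _]|[D _ _ _ F]] := valid_bvar vS.
    by move: lc; rewrite cE; case: (b).
  by apply: dg_leq D; move: F; rewrite dgE; lia.
have nDm : ~~ dg b mu m (line b c).+1.
  by apply: contraNN nD => D; apply: dg_leq D; lia.
apply: (H m); first by lia.
by move: nDm Dm; rewrite !dgE; lia.
Qed.

Lemma initial_no_pred (mu la : partition_shape) (st st' : state) :
  initial mu la st' -> valid_state mu la st -> ~ step mu la st st'.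
Proof.
case: st st' => -[S c] w [[S' c'] w'] [/= _ -> adm] vS.
case/stepP=> [[e [old [_ D _ _ _]]]|]; first by rewrite in_diagram in D.
move=> [d [e [pl oc nF [_ wE]]]]; rewrite wE in adm.
exact: restart_not_admissible vS pl oc nF adm.
Qed.

(** * Existence of predecessors *)

(** The variable came from the last position [i] of the preceding line where the index is at most
    [k], or from the origin if there is no preceding line. The bound at [i] is a hypothesis, as its
    proof differs between targets that satisfy the bound and corners that violate it. *)
Lemma insertion_point_pred (mu la : partition_shape) (S : filling) (b : color)
    (k r l : nat) :
  bounded_tableaux mu la S -> insertion_point mu S b k l r ->
  (1 < l -> cval S (place b r l.-1) <= k - r) -> dg b la k 1 ->
  (forall i, r <= i <= k -> dg b mu i l.-1 ->
     (dg b mu i.+1 l.-1 -> k <= i + cval S (place b i.+1 l.-1)) ->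
     dg b la k (l.-1 + k - i)) ->
  exists2 c, valid_state mu la (S, c, bvar b k)
    & placement mu S c (bvar b k) (place b r l) (b, k - r).
Proof.
move=> bS ip left Dk bound; have [r0 l0] := insertion_point_gt0 ip.
suff [c vS lE] : exists2 c, valid_state mu la (S, c, bvar b k) &
    l = (line b c).+1.
  by exists c => //; rewrite lE in ip *; apply: insertion_point_placement bS ip.
have [l1|l1] := leqP l 1.
  exists (0, 0); last by case: (b) => /=; lia.
  by split=> //; exists b, k; split=> //; left.
have [Drl rk _ next] := ip.
have D : dg b mu r l.-1.
  case: Drl => [D|/outer_corner_place[_ _ _ _ [?|//]]]; last by lia.
  by apply: dg_leq D; lia.
pose P i := dg b mu i l.-1 && (i + cval S (place b i l.-1) <= k).
have exP : exists i, P i by exists r; rewrite /P D; have := left l1; lia.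
have maxP i : P i -> i <= k by rewrite /P; lia.
case: (ex_maxnP exP maxP) => i /andP[Di ik] maxi.
have ri : r <= i by apply: maxi; rewrite /P D; have := left l1; lia.
have nexti : dg b mu i.+1 l.-1 -> k <= i + cval S (place b i.+1 l.-1).
  by move=> D'; have := contraNN (maxi i.+1); rewrite /P D' /=; lia.
exists (place b i l.-1); last by rewrite line_place; lia.
split=> //; exists b, k; split=> //; right; rewrite pos_place line_place.
split=> //; last by apply: bound => //; lia.
rewrite prednK // => Dil.
have Drl' : dg b mu r l by apply: dg_leq Dil; lia.
have := bounded_leq bS (r1 := r) (l1 := l) _ _ Dil.
by have := next Drl'; lia.
Qed.

(** The source lies one line earlier, at a position [i >= r], so its bound follows from that of the
    target. *)
Lemma fitting_pred (mu la : partition_shape) (S : filling) (b : color)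
    (r l t : nat) :
  bounded_tableaux mu la S ->
  dg b mu r l \/ outer_corner mu (place b r l) ->
  (1 < r -> cval S (place b r.-1 l) <= t) ->
  (1 < l -> cval S (place b r l.-1) <= t) ->
  (dg b mu r l -> t <= cval S (place b r l)) ->
  dg b la (r + t) (l + t) ->
  exists2 c, valid_state mu la (S, c, bvar b (r + t))
    & placement mu S c (bvar b (r + t)) (place b r l) (b, t).
Proof.
move=> bS Drl r1 l1 next F; have tE : r + t - r = t by lia.
rewrite -{3}tE; apply: insertion_point_pred => //.
- split=> //; [lia | by move=> r1'; have := r1 r1'; lia |].
  by move=> D; have := next D; lia.
- by rewrite tE.
- by have [? ?] := dg_gt0 F; apply: dg_leq F; lia.
by move=> i ri D _; have [? ?] := dg_gt0 D; apply: dg_leq F; lia.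
Qed.

(** The entry now in [c] did the bumping. Putting the bumped entry back gives the previous filling
    [S0], and [fitting_pred] finds where the bumping variable came from. *)
Lemma bumped_pred (mu la : partition_shape) (S : filling) (c : cell)
    (b : color) (k : nat) :
  bounded_tableaux mu la S -> bumped mu la S b k (pos b c) (line b c) ->
  exists2 st, valid_state mu la st & step mu la st (S, c, bvar b k).
Proof.
move=> bS [D le nextl nextr F]; have [p0 l0] := dg_gt0 D.
have cmu : c \in diagram mu by rewrite -(placeK b c).
have [dS _ _] := (boundedP _ _ _).1 bS.
have [|[b' t] E vE] := @fnd_domf S c; first by rewrite dS.
pose old := (b, k - pos b c); pose S0 := S.[c <- old].
have bS0 : bounded_tableaux mu la S0.
  rewrite /S0 -(placeK b c); apply: bounded_raise => //=; rewrite ?placeK.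
  - by move: le; rewrite placeK; lia.
  - by move=> /nextr; lia.
  - by move=> /nextl; lia.
  by move: F; rewrite subnKC -?addnBA //; lia.
have cE := placeK b' c; have D' : dg b' mu (pos b' c) (line b' c).
  by rewrite /dg cE.
have [p0' l0'] := dg_gt0 D'.
have [||||||c0 v0 pl] := @fitting_pred mu la S0 b' (pos b' c) (line b' c) t.
- exact: bS0.
- by left.
- move=> r1; rewrite /S0 -{1}cE cval_set place_eq ifF; last by lia.
  have := vE; rewrite -{1}cE => /= <-; apply: bounded_leq bS _ _ D'; lia.
- move=> l1; rewrite /S0 -{1}cE cval_set place_eq ifF; last by lia.
  have := vE; rewrite -{1}cE => /= <-; apply: bounded_leq bS _ _ D'; lia.
- move=> _; rewrite cE cval_set eqxx /=.
  by move: le; rewrite placeK vE /=; lia.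
- by have := bounded_fits bS D'; rewrite cE vE.
rewrite cE in pl.
have cS0 : S0.[? c] = Some old by rewrite fnd_set eqxx.
have := step_bump la pl cmu cS0.
have -> : S0.[c <- (b', t)] = S.
  by apply/fmapP => d; rewrite !fnd_set; case: eqP => [->|].
rewrite repr_varE subnKC; last by lia.
by move=> st; eexists; [exact: v0 | exact: st].
Qed.

(** From [la_k - k = mu_m - m], the restart corner is the one in line [l = mu_m + 1], at the first
    position [r] outside [mu]. As [r <= m], the bound fails there: [l + k - r > la_k]. *)
Lemma not_admissible_pred (mu la : partition_shape) (S : filling)
    (b : color) (k : nat) :
  bounded_tableaux mu la S -> dg b la k 1 ->
  ~ admissible_vars mu la (bvar b k) ->
  exists2 st, valid_state mu la st & step mu la st (S, (0, 0), bvar b k).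
Proof.
move=> bS Dk nadm; have [k0 _] := dg_gt0 Dk.
have [m m0 mE] : exists2 m, 0 < m & bpart b la k + m = bpart b mu m + k.
  apply: contrapT => nex; apply: nadm; apply/admissible_bvar; split=> // m m0 mE.
  by apply: nex; exists m.
have [l lE] : exists l, l = (bpart b mu m).+1 by eexists.
have nDm : ~~ dg b mu m l by rewrite dgE; lia.
pose P r := (0 < r) && ~~ dg b mu r l.
have exP : exists r, P r by exists m; rewrite /P m0.
case: (ex_minnP exP) => r /andP[r0 nD] minr.
have rm : r <= m by apply: minr; rewrite /P m0.
have pred : 1 < r -> dg b mu r.-1 l.
  by move=> r1; have := contraNN (minr r.-1); rewrite /P; lia.
have Dleft i : 0 < i <= m -> 1 < l -> dg b mu i l.-1.
  by move=> im l1; apply: (@dg_leq _ _ m (bpart b mu m)); rewrite ?dgE; lia.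
have oc : outer_corner mu (place b r l).
  apply/outer_corner_place; split=> //; first by rewrite lE.
    by have [/pred|] := ltnP 1 r; [right | left; lia].
  have [l1|l1] := ltnP 1 l; last by left; lia.
  by right; apply: Dleft; lia.
(* A larger value would force [la_k - k] to exceed [mu_m - m]. *)
have small p q : dg b mu p q -> p + l <= q + m.+1 -> p + cval S (place b p q) <= k.
  move=> D pq; rewrite leqNgt; apply/negP => lt.
  have : dg b la k (q + cval S (place b p q)).
    by have [? ?] := dg_gt0 D; apply: dg_leq (bounded_fits bS D); lia.
  by rewrite dgE; lia.
have rk : r <= k.
  have [l1|l1] := ltnP 1 l; last by lia.
  by have := small r l.-1 (Dleft r _ l1); lia.
have [||l1||i rik D next|c vS pl] := @insertion_point_pred mu la S b k r l.
- exact: bS.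
- split=> //; [by right | | by rewrite (negPf nD)].
  move=> r1; have Dr := pred r1; rewrite ltnNge; apply/negP => le.
  have : dg b la k (l + cval S (place b r.-1 l)).
    by have [? ?] := dg_gt0 Dr; apply: dg_leq (bounded_fits bS Dr); lia.
  by rewrite dgE; lia.
- by have := small r l.-1 (Dleft r _ l1); lia.
- exact: Dk.
(* If [i < m], then [small] at [i.+1] contradicts the choice of [i] as the last position. So
   [m <= i], and the bound follows from [mE]. *)
- have [im|mi] := ltnP i m.
    have l1 : 1 < l by have := dg_gt0 D; lia.
    have D' : dg b mu i.+1 l.-1 by apply: Dleft l1; lia.
    by have := next D'; have := small _ _ D'; lia.
  by have := dg_gt0 D; rewrite dgE; lia.
exists (S, c, bvar b k) => //; apply: step_restart pl oc _.
by rewrite fits_inside_place subnKC // dgE /=; lia.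
Qed.

Lemma valid_pred (mu la : partition_shape) (st : state) :
  valid_state mu la st -> ~ initial mu la st ->
  exists2 st', valid_state mu la st' & step mu la st' st.
Proof.
case: st => -[S c] w vS; case: (vS) => bS [b [k [-> [[-> Dk]|B]]]] ninit.
  by apply: not_admissible_pred => // adm; apply: ninit.
exact: bumped_pred.
Qed.

Lemma covering_pred (mu la : partition_shape) (S' : filling) :
  covering_tableaux mu la S' ->
  exists2 st, valid_state mu la st & output mu la st S'.
Proof.
move=> /covering_remove[b [r [l [t [oc E [bS F] r1 l1]]]]].
have nD := outer_corner_notin oc.
have next : dg b mu r l -> t <= cval S'.[~ place b r l] (place b r l).
  by rewrite /dg (negPf nD).
have [c vS pl] := fitting_pred bS (or_intror oc) r1 l1 next F.
eexists; first exact: vS.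
have SE : S'.[~ place b r l].[place b r l <- (b, t)] = S'.
  by apply/fmapP => d; rewrite fnd_set fnd_rem1; case: eqP => [->|].
have := @output_intro mu la _ _ _ _ _ pl oc.
by rewrite SE fits_inside_place; apply.
Qed.

(** * Injective partial dynamics on a finite set *)

Definition on (V : Type) (P : V -> Prop) (E : V -> V -> Prop) : V -> V -> Prop :=
  fun x y => [/\ P x, P y & E x y].

(* An infinite run would be eventually periodic, and going back along it by
   injectivity would produce a predecessor of its first element. *)
Lemma run_ends (V : Type) (F : finType) (code : V -> F) (P Q : V -> Prop)
    (E : V -> V -> Prop) (a : V) :
  (forall x y, P x -> P y -> code x = code y -> x = y) ->
  (forall x y z, P x -> P y -> E x z -> E y z -> x = y) ->
  (forall x, P x -> Q x \/ exists2 y, P y & E x y) ->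
  P a -> (forall x, P x -> ~ E x a) ->
  exists b, [/\ P b, Q b & clos_refl_trans V (on P E) a b].
Proof.
move=> codeI Einj next Pa nopred.
(* Every visited state other than [a] has a visited predecessor different from the current [x]; by
   injectivity a successor of [x] is therefore new. *)
pose inv (seen : {set F}) x := forall y, P y -> code y \in seen ->
  y = a \/ exists z, [/\ P z, code z \in seen, z <> x & E z y].
have fresh seen x y : inv seen x -> P x -> P y -> E x y -> code y \notin seen.
  move=> xinv Px Py Exy; apply/negP => yseen.
  have [yE|[z [Pz _ nzx Ezy]]] := xinv y Py yseen.
    by case: (nopred x Px); rewrite -yE.
  by case: nzx; apply: Einj Ezy Exy.
suff main n : forall (seen : {set F}) x, #|~: seen| <= n ->
    P x -> code x \in seen -> clos_refl_trans V (on P E) a x -> inv seen x ->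
    exists b, [/\ P b, Q b & clos_refl_trans V (on P E) a b].
  apply: (main _ [set code a] a (leqnn _)) => //; rewrite ?set11 //.
    exact: rt_refl.
  by move=> y Py; rewrite inE => /eqP /(codeI _ _ Py Pa); left.
elim: n => [|n IHn] seen x card Px xseen ax xinv.
  have [?|[y Py Exy]] := next x Px; first by exists x.
  have := fresh _ _ _ xinv Px Py Exy; move: card.
  by rewrite leqn0 cards_eq0 => /eqP/setP/(_ (code y)); rewrite !inE => ->.
have [?|[y Py Exy]] := next x Px; first by exists x.
have yseen := fresh _ _ _ xinv Px Py Exy.
apply: (IHn (code y |: seen) y) => //; rewrite ?setU11 //.
- rewrite -ltnS; apply: leq_trans card; apply: proper_card.
  rewrite finset.setCU properE finset.subsetIr /=; apply/subsetPn; exists (code y).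
    by rewrite inE.
  by rewrite !inE eqxx.
- by apply: rt_trans ax _; apply: rt_step.
move=> u Pu; rewrite !inE => /orP[/eqP/(codeI _ _ Pu Py) ->|useen].
  right; exists x; split=> //; first by rewrite !inE xseen orbT.
  by move=> xy; rewrite xy (negPf yseen) in xseen.
have [|[z [Pz zseen _ Ezu]]] := xinv u Pu useen; first by left.
right; exists z; split=> //; first by rewrite !inE zseen orbT.
by move=> zy; rewrite -zy zseen in yseen.
Qed.

Lemma run_rev (V : Type) (P : V -> Prop) (E : V -> V -> Prop) (a b : V) :
  clos_refl_trans V (on P (fun x y => E y x)) a b ->
  clos_refl_trans V (on P E) b a.
Proof.
elim=> [x y [Px Py Exy]|x|x y z _ IH1 _ IH2].
- exact: rt_step.
- exact: rt_refl.
- exact: rt_trans IH2 IH1.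
Qed.

(** Going back from [b], injectivity keeps both runs together, and neither can be continued beyond a
    start. *)
Lemma run_start_unique (V : Type) (P : V -> Prop) (E : V -> V -> Prop)
    (a1 a2 b : V) :
  (forall x y z, P x -> P y -> E x z -> E y z -> x = y) ->
  (forall x, P x -> ~ E x a1) -> (forall x, P x -> ~ E x a2) ->
  clos_refl_trans V (on P E) a1 b -> clos_refl_trans V (on P E) a2 b -> a1 = a2.
Proof.
move=> Einj no1 no2 /clos_rt_rtn1_iff; elim=> [|y z [Py _ Eyz] _ IH].
  by move=> /clos_rt_rtn1_iff H; case: H no1 => // y z [Py _ Eyz] _ /(_ y Py).
move=> /clos_rt_rtn1_iff H; apply: IH; case: H Eyz no2 => [Eyz|y' z' [Py' _ Eyz'] H Eyz _].
  by move=> /(_ y Py).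
by rewrite (Einj _ _ _ Py Py' Eyz Eyz'); apply/clos_rt_rtn1_iff.
Qed.

(** * Finiteness of the set of valid states *)

(** Number of columns plus number of rows of [la]: a common bound for both coordinates of its
    cells. *)
Definition index_bound (la : partition_shape) : nat := part la 1 + cpart la 1.

Definition encode (N : nat) (e : entry) : bool * 'I_N.+1 :=
  (if e.1 is Black then true else false, inord e.2).

Lemma encode_inj (N : nat) (e1 e2 : entry) :
  e1.2 <= N -> e2.2 <= N -> encode N e1 = encode N e2 -> e1 = e2.
Proof.
case: e1 e2 => [b1 t1] [b2 t2] /= le1 le2 [bE /(congr1 val)].
by rewrite /= !inordK // => ->; congr pair; case: b1 b2 bE => [] [].
Qed.

Lemma dg_bound (la : partition_shape) (b : color) (r l : nat) :
  dg b la r l -> r <= index_bound la /\ l <= index_bound la.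
Proof.
move=> D; have [r0 l0] := dg_gt0 D.
have : dg b la r 1 by apply: dg_leq D; lia.
have : dg b la 1 l by apply: dg_leq D; lia.
by rewrite -(dg_flip b la 1) !dgE /index_bound; case: (b) => /=; lia.
Qed.

Definition state_code (mu la : partition_shape) (st : state) :
    {ffun diagram mu -> bool * 'I_(index_bound la).+1} *
    ('I_(index_bound la).+1 * 'I_(index_bound la).+1) *
    (bool * 'I_(index_bound la).+1) :=
  ([ffun c => encode _ (odflt (Black, 0) st.1.1.[? val c])],
   (inord st.1.2.1, inord st.1.2.2),
   encode _ (match st.2 with X_ k => (Black, k) | Y_ k => (Red, k) end)).

(** Truncation by [inord] loses nothing: cells, values and indices of valid states are bounded by
    coordinates of cells of [la]. The default entry does not interfere, since every cell of [mu] is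
    filled. *)
Lemma state_code_inj (mu la : partition_shape) (st1 st2 : state) :
  valid_state mu la st1 -> valid_state mu la st2 ->
  state_code mu la st1 = state_code mu la st2 -> st1 = st2.
Proof.
case: st1 st2 => -[S1 c1] w1 [[S2 c2] w2].
have [b1 [k1 ->]] := bvarP w1; have [b2 [k2 ->]] := bvarP w2.
move=> v1 v2 [/ffunP SE E1 E2 bE kE].
have [k1N _] := dg_bound (valid_index v1); have [k2N _] := dg_bound (valid_index v2).
have cN (S : filling) c b k : valid_state mu la (S, c, bvar b k) ->
    c.1 <= index_bound la /\ c.2 <= index_bound la.
  move=> v; have [[-> //]|[D _ _ _ _]] := valid_bvar v.
  by move/(bounded_contained v.1)/dg_bound: D; case: (b) => -[].
have tN (S : filling) d (e : entry) : bounded_tableaux mu la S ->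
    S.[? d] = Some e -> e.2 <= index_bound la.
  case: d => i j bS E; have D := domf_fnd E.
  have [[dS _ _] _] := bS; rewrite dS in D.
  have [] := dg_bound (bounded_fits (b := Black) bS D).
  by rewrite /cval /= E; lia.
have cE : c1 = c2.
  have [? ?] := cN _ _ _ _ v1; have [? ?] := cN _ _ _ _ v2.
  move: E1 E2 => /(congr1 val) + /(congr1 val); rewrite /= !inordK // => e1 e2.
  by rewrite (surjective_pairing c1) e1 e2 -surjective_pairing.
have fE : S1 = S2.
  have [[dS1 _ _] _] := v1.1; have [[dS2 _ _] _] := v2.1.
  apply/fmapP => d; have [dD|nD] := boolP (d \in diagram mu); last first.
    have n1 := nD; rewrite -dS1 in n1; have n2 := nD; rewrite -dS2 in n2.
    by rewrite !not_fnd.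
  have := SE [` dD]; rewrite !ffunE /=.
  have [e1 F1 _] : exists2 e, S1.[? d] = Some e & cval S1 d = e.2.
    by apply: fnd_domf; rewrite dS1.
  have [e2 F2 _] : exists2 e, S2.[? d] = Some e & cval S2 d = e.2.
    by apply: fnd_domf; rewrite dS2.
  rewrite F1 F2 /= => /encode_inj -> //; first exact: tN v1.1 F1.
  exact: tN v2.1 F2.
have /encode_inj : encode (index_bound la) (b1, k1) = encode _ (b2, k2).
  by move: bE kE; rewrite /encode; case: (b1) (b2) => [] [] //= _ ->.
by move=> /(_ k1N k2N) [-> ->]; rewrite cE fE.
Qed.

(** * Weights *)

Lemma weight_set (S : filling) (c : cell) (e : entry) : c \notin domf S ->
  weight S.[c <- e] = mmul (weight S) (ucm (repr_var c e)).
Proof.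
(* A function of all cells, so that the product can run over the plain finite set [domf f]. *)
pose F (f : filling) d := if f.[? d] is Some e then ucm (repr_var d e) else mone.
have weightE (f : filling) : weight f = \big[mmul/mone]_(d <- domf f) F f d.
  rewrite big_seq_fsetE; apply: eq_bigr => -[d df] _ /=.
  by rewrite /F in_fnd.
move=> cS; rewrite !weightE dom_setf big_fsetU1 //= {1}/F fnd_set eqxx mulmC.
congr mmul; apply: eq_big_seq => d dS; rewrite /F fnd_set; case: eqP => // dE.
by rewrite -dE dS in cS.
Qed.

Lemma weight_replace (S : filling) (c : cell) (e old : entry) :
  S.[? c] = Some old ->
  mmul (weight S.[c <- e]) (ucm (repr_var c old)) =
  mmul (weight S) (ucm (repr_var c e)).
Proof.
move=> E; have SE : S.[~ c].[c <- old] = S.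
  by apply/fmapP => d; rewrite fnd_set fnd_rem1; case: eqP => [->|].
have nc : c \notin domf S.[~ c] by rewrite domf_rem in_fsetD in_fset1 eqxx.
rewrite -setf_rem1 -[in RHS]SE !weight_set // -!mulmA; congr mmul.
by rewrite mulmC.
Qed.

Lemma step_weight (mu la : partition_shape) (st st' : state) :
  step mu la st st' ->
  mmul (weight st.1.1) (ucm st.2) = mmul (weight st'.1.1) (ucm st'.2).
Proof.
case=> //= S c w c' e old pl _ E; rewrite (weight_replace _ E).
by rewrite (placement_repr pl).
Qed.

Lemma output_weight (mu la : partition_shape) (st : state) (S' : filling) :
  valid_state mu la st -> output mu la st S' ->
  weight S' = mmul (weight st.1.1) (ucm st.2).
Proof.
case: st => -[S c] w [bS _] /outputP[d [e [pl oc _ ->]]] /=.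
rewrite weight_set ?(placement_repr pl) //; have [[dS _ _] _] := bS.
by rewrite dS; apply: outer_corner_notin.
Qed.

(** * Repeated insertion *)

Lemma insertion_from_det (mu : partition_shape) (S : filling) (c : cell)
    (w : var) (S1 S2 : filling) :
  insertion_from mu S c w S1 -> insertion_from mu S c w S2 -> S1 = S2.
Proof.
move=> H; elim: H S2 => {S c w S1}.
  move=> S c w c1 e1 pl1 oc1 S2 H.
  inversion H as [? ? ? c2 e2 pl2 oc2|? ? ? c2 e2 old2 ? pl2 D2]; subst;
    have [cE eE] := placement_det pl1 pl2; first by rewrite cE eE.
  by move/negP: (outer_corner_notin oc1); rewrite cE.
move=> S c w c1 e1 old1 S1 pl1 D1 E1 _ IH S2 H.
inversion H as [? ? ? c2 e2 pl2 oc2|? ? ? c2 e2 old2 ? pl2 D2 E2 H2]; subst;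
    have [cE eE] := placement_det pl1 pl2.
  by move/negP: (outer_corner_notin oc2); rewrite -cE.
rewrite -cE -eE in E2 H2; apply: IH.
by move: E2 H2; rewrite E1 => -[<-].
Qed.

Lemma repeated_insertion_det (mu la : partition_shape) (T : filling) (z : var)
    (S1 S2 : filling) :
  repeated_insertion mu la T z S1 -> repeated_insertion mu la T z S2 -> S1 = S2.
Proof.
move=> H; elim: H S2 => {T z S1}.
  move=> T z S1 i1 cov1 S2 H.
  inversion H as [? ? ? i2 _|? ? S ? ? ? i2 ncov]; subst.
    exact: insertion_from_det i1 i2.
  by case: ncov; rewrite -(insertion_from_det i1 i2).
move=> T z S c e S1 i1 ncov1 dE E _ IH S2 H.
inversion H as [? ? ? i2 cov2|? ? S' c' e' ? i2 _ dE' E' H2]; subst.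
  by case: ncov1; rewrite (insertion_from_det i1 i2).
have SE := insertion_from_det i1 i2; rewrite -{}SE in dE' E' H2.
have /eqP cE : c' == c by rewrite -in_fset1 -dE dE' in_fset1.
rewrite {}cE in E' H2; apply: IH.
by move: E' H2; rewrite E => -[<-].
Qed.

(** What repeated insertion does once a single insertion has returned [S]. Splitting this off allows
    an induction over runs that start in the middle of an insertion. *)
Definition continues (mu la : partition_shape) (S S' : filling) : Prop :=
  covering_tableaux mu la S /\ S' = S \/
  exists c e, [/\ ~ covering_tableaux mu la S, domf S `\` diagram mu = [fset c],
    S.[? c] = Some e & repeated_insertion mu la S.[~ c] (repr_var c e) S'].

Lemma continues_repeated (mu la : partition_shape) (T : filling) (z : var)
    (S S' : filling) :
  insertion mu T z S -> continues mu la S S' -> repeated_insertion mu la T z S'.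
Proof.
move=> i [[cov ->]|[c [e [ncov dE E H]]]].
  exact: repeated_insertion_stop.
exact: repeated_insertion_again H.
Qed.

(** A bump prolongs the current insertion. A restart completes it at a corner violating the bound;
    removing the new entry gives back the filling and the variable from which the rest of the run
    starts. *)
Lemma run_insertion (mu la : partition_shape) (st st' : state) (S' : filling) :
  clos_refl_trans state (on (valid_state mu la) (step mu la)) st st' ->
  valid_state mu la st' -> output mu la st' S' ->
  exists2 S, insertion_from mu st.1.1 st.1.2 st.2 S & continues mu la S S'.
Proof.
move=> /clos_rt_rt1n_iff; elim=> {st st'} [st|st1 st2 st3 [v1 v2 s12] _ IH] v3 out.
  exists S'; last by left; split=> //; apply: output_covering out.
  by case: out {v3} => S c w c' e pl oc _ /=; apply: insertion_stop.
have {IH} := IH v3 out; case: s12 v1 v2 => /=.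
  move=> S c w c' e old pl D E _ _ [S1 i1 cont].
  by exists S1 => //; apply: insertion_bump pl D E i1.
move=> S c w c' e pl oc nF v1 _ [S1 i1 cont].
have [[dS _ _] _] := v1.1.
have nc := outer_corner_notin oc.
exists S.[c' <- e]; first exact: insertion_stop.
right; exists c', e; split.
- move=> cov; move/negP: nF; apply.
  have := covering_fits cov (c := c'); rewrite dom_setf fset1U1 => /(_ isT).
  by rewrite cval_set eqxx.
- rewrite dom_setf dS; apply/fsetP => d.
  by rewrite in_fsetD in_fset1U in_fset1; case: eqP => [->|_]; rewrite ?nc ?andNb.
- by rewrite fnd_set eqxx.
rewrite remf1_set eqxx remf1_id; last by rewrite -dS in nc.
by rewrite (placement_repr pl); apply: continues_repeated i1 cont.
Qed.

Lemma run_weight (mu la : partition_shape) (st st' : state) :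
  clos_refl_trans state (on (valid_state mu la) (step mu la)) st st' ->
  mmul (weight st.1.1) (ucm st.2) = mmul (weight st'.1.1) (ucm st'.2).
Proof.
by elim=> [x y [_ _ /step_weight] | | x y z _ -> _ ->].
Qed.

Lemma initial_run (mu la : partition_shape) (st : state) :
  initial mu la st -> exists st' S, [/\ valid_state mu la st',
    output mu la st' S &
    clos_refl_trans state (on (valid_state mu la) (step mu la)) st st'].
Proof.
move=> init; have [//||||x vx|b [vb [S out] ab]] := 
  @run_ends _ _ (@state_code mu la) (valid_state mu la)
  (fun st => exists S, output mu la st S) (step mu la) st.
- exact: state_code_inj.
- by move=> x y z vx vy; apply: step_inj.
- by move=> x /valid_step[|]; [right | left].
- exact: initial_valid.
- exact: initial_no_pred init vx.
by exists b, S.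
Qed.

(** [run_ends] is applied to the reversed steps: determinism becomes injectivity, and an output
    state, having no successor, becomes a start. *)
Lemma output_run (mu la : partition_shape) (st' : state) (S : filling) :
  valid_state mu la st' -> output mu la st' S -> exists2 st, initial mu la st &
    clos_refl_trans state (on (valid_state mu la) (step mu la)) st st'.
Proof.
move=> vst' out; have [|||//|x _|b [vb init ab]] := 
  @run_ends _ _ (@state_code mu la) (valid_state mu la)
  (initial mu la) (fun x y => step mu la y x) st'.
- exact: state_code_inj.
- by move=> x y z _ _; apply: step_det.
- move=> x vx; have [?|ninit] := pselect (initial mu la x); first by left.
  by right; apply: valid_pred.
- exact: output_step out.
by exists b => //; apply: run_rev.
Qed.

(** * The bijection *)

Local Open Scope classical_set_scope.

Theorem theorem4p5 (mu la : partition_shape) :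
  exists Psi : filling * var -> filling,
    [/\ forall (T : filling) (z : var),
          bounded_tableaux mu la T -> admissible_vars mu la z ->
          forall S : filling,
            repeated_insertion mu la T z S <-> S = Psi (T, z),
        set_bij (bounded_tableaux mu la `*` admissible_vars mu la)
                (covering_tableaux mu la) Psi
      & forall (T : filling) (z : var),
          bounded_tableaux mu la T -> admissible_vars mu la z ->
          weight (Psi (T, z)) = pair_weight (T, z)].
Proof.
pose run := clos_refl_trans state (on (valid_state mu la) (step mu la)).
pose start T z : state := (T, (0, 0), z).
(* Choice makes a total function of the deterministic relation; pairs without a result get the
   arbitrary value [p.1]. *)
have [p|Psi PsiP] := @choice (filling * var) filling (fun p S =>
    (exists S', repeated_insertion mu la p.1 p.2 S') ->
    repeated_insertion mu la p.1 p.2 S).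
  have [[S H]|nex] := pselect (exists S, repeated_insertion mu la p.1 p.2 S).
    by exists S.
  by exists p.1 => /nex.
have PsiE T z S : repeated_insertion mu la T z S -> Psi (T, z) = S.
  move=> H; have H' := PsiP (T, z) (ex_intro _ S H).
  exact: repeated_insertion_det H' H.
have run_rep T z st S : run (start T z) st -> valid_state mu la st ->
    output mu la st S -> repeated_insertion mu la T z S.
  move=> r v /(run_insertion r v)[S1 i1 cont].
  exact: continues_repeated i1 cont.
have ends T z : bounded_tableaux mu la T -> admissible_vars mu la z ->
    exists st, [/\ valid_state mu la st, output mu la st (Psi (T, z))
      & run (start T z) st].
  move=> bT adm.
  have [|st [S [v out r]]] := @initial_run mu la (start T z); first by split.
  by exists st; rewrite (PsiE _ _ _ (run_rep _ _ _ _ r v out)).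
exists Psi; split.
- move=> T z bT adm S; split=> [/PsiE //|->].
  by have [st [v out r]] := ends T z bT adm; apply: run_rep r v out.
- split.
  + move=> [T z] [/= bT adm]; have [st [v out r]] := ends T z bT adm.
    exact: output_covering out.
  (* Injectivity: equal outputs come from the same last state, and runs into the same state have the
     same start. *)
  + move=> [T1 z1] [T2 z2]; rewrite !inE => -[/= b1 a1] [/= b2 a2] PE.
    have [st1 [v1 out1 r1]] := ends _ _ b1 a1.
    have [st2 [v2 out2 r2]] := ends _ _ b2 a2.
    rewrite PE in out1; have stE := output_inj v1 v2 out1 out2.
    rewrite {}stE in r1.
    have i1 : initial mu la (start T1 z1) by split.
    have i2 : initial mu la (start T2 z2) by split.
    have [-> -> //] : start T1 z1 = start T2 z2.
    apply: run_start_unique r1 r2.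
    * by move=> x y z vx vy; apply: step_inj.
    * by move=> x; apply: initial_no_pred.
    * by move=> x; apply: initial_no_pred.
  (* Surjectivity: a last state producing [S] is traced back to an initial state. *)
  + move=> S /covering_pred[st v out].
    have [[[T c] z] [/= bT cE adm] r] := output_run v out.
    rewrite {}cE in r; exists (T, z); first by split.
    by apply: PsiE; apply: run_rep r v out.
move=> T z bT adm; have [st [v out r]] := ends T z bT adm.
by rewrite (output_weight v out) -(run_weight r).
Qed.
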